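(* Fix $\lambda>0$, $\alpha>0$, $r_0>0$, $s_0>0$ and assume that the Cluster Assumption CA($\lambda$) holds. Consider an estimator $\hat G_m$ of $\Gamma(\lambda)$ based on $\mathbb{X}_u$ that is consistent from inside at rate $m^{-\alpha}$. If the connected components of $\Gamma(\lambda)$ are $r_0$-connected and $s_0$-separated, then the classifier $\tilde g_{n,m}$ satisfies, for any $0<\theta<1$, $$ \mathcal{E}_{\lambda}(\tilde g_{n,m})\le \widetilde O\left(\frac{m^{-\alpha}}{1-\theta}\right)+\sum_{j\ge1}\delta_j\,e^{-n(\theta\delta_j)^2/2}. $$ Moreover, if the Global Margin Assumption GMA($\lambda$) holds with constant $\delta>0$, then for any $0<\theta<1$, $$ \mathcal{E}_{\lambda}(\tilde g_{n,m})\le \widetilde O\left(\frac{m^{-\alpha}}{1-\theta}\right)+e^{-n(\theta\delta)^2/2}. $$ Here $\widetilde O\big(\frac{m^{-\alpha}}{1-\theta}\big)$ stands for a quantity bounded by $C(\log m)^{b}\,\frac{m^{-\alpha}}{1-\theta}$ with constants $C,b>0$ not depending on $m$, $n$, $\theta$.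
   Context: Let $(X,Y)$ be a random couple with joint distribution $P$, $X\in\mathcal{X}\subset\mathbb{R}^d$, $Y\in\{0,1\}$. The marginal $P_X$ of $X$ has a density $p$ with respect to Lebesgue measure $\mathrm{Leb}_d$ on $\mathbb{R}^d$; $\eta(x)=P(Y=1\mid X=x)$; the Bayes classifier is $g^\star(x)=\mathbf{1}_{\{\eta(x)\ge1/2\}}$. Standing assumptions: $p$ is uniformly bounded by a constant $L(p)$ and $\mathrm{Leb}_d(\mathcal{X})<\infty$. One observes two independent samples: labeled $\mathbb{X}_l=\{(X_1,Y_1),\dots,(X_n,Y_n)\}$ (independent copies of $(X,Y)$) and unlabeled $\mathbb{X}_u=\{X_{n+1},\dots,X_{n+m}\}$ (independent copies of $X$). $\mathbb{E}_m$ denotes expectation with respect to $\mathbb{X}_u$, and $\mathbb{E}_{n,m}$ with respect to $(\mathbb{X}_l,\mathbb{X}_u)$. Level set: $\Gamma=\Gamma(\lambda)=\{x\in\mathcal{X}:p(x)\ge\lambda\}$, assumed to have a countable number of connected components $T_j=T_j(\lambda)$, $j=1,2,\dots$: $\Gamma=\bigsqcup_{j\ge1}T_j$ with $T_j$ nonempty, disjoint, connected. Cluster Assumption CA($\lambda$): $\Gamma(\lambda)$ has a countable number of connected components $T_j$, and the function $x\in\mathcal{X}\mapsto\mathbf{1}_{\{\eta(x)\ge1/2\}}$ takes a constant value on each $T_j$. Define $\delta_j=\int_{T_j}|2\eta(x)-1|p(x)\,dx\in[0,1]$. Global Margin Assumption GMA($\lambda$): there exists $\delta>0$ such that for every $j\ge1$,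 either $\delta_j=0$ or $\delta_j\ge\delta$. Notation: $u_m=\widetilde O(v_m)$ if there are constants $C>0$, $b>0$ with $u_m\le C(\log m)^bv_m$. $A\triangle B$ is the symmetric difference. $\mathcal{B}(x,r)=\{y\in\mathbb{R}^d:\|y-x\|\le r\}$ with the Euclidean norm. $r_0$-connected: fix $r_0\ge0$ and a constant $c_0>0$. A set $C\subset\mathbb{R}^d$ is $r_0$-connected if for any $x,x'\in C$ there is a continuous map $f:[0,1]\to C$ with $f(0)=x$, $f(1)=x'$ such that for all $t\in[0,1]$ and all $r\le r_0$, $\mathrm{Leb}_d(\mathcal{B}(f(t),r)\cap C)\ge c_0r^d$. A $0$-connected set is simply called connected (i.e. pathwise connected). Separation: $d_\infty(C_1,C_2)=\inf_{x\in C_1,y\in C_2}\|x-y\|$. A collection of connected sets $C_1,C_2,\dots$ is $s_0$-separated if $d_\infty(C_j,C_{j'})\ge s_0$ for all $j\ne j'$. Consistency from inside: an estimator $\hat G_m\subset\mathcal{X}$ of $\Gamma$, constructed from $\mathbb{X}_u$, is consistent from inside at rate $m^{-\alpha}$ if $\mathbb{E}_m[\mathrm{Leb}_d(\hat G_m\triangle\Gamma)]=\widetilde O(m^{-\alpha})$ and $\mathbb{E}_m[\mathrm{Leb}_d(\hat G_m\cap\Gamma^c)]=\widetilde O(m^{-2\alpha})$. Clipping and merging: let $$\mathrm{Clip}(\hat G_m)=\Big\{x\in\hat G_m:\mathrm{Leb}_d\big(\hat G_m\cap\mathcal{B}(x,(\log m)^{-1})\big)\le \frac{(\log m)^{-d}}{m^{\alpha}}\Big\},\qquad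 \tilde G_m=\hat G_m\setminus\mathrm{Clip}(\hat G_m).$$ Write $\tilde G_m=\bigsqcup_{l\ge1}\tilde T_l$ for its decomposition into connected components. The sets $\tilde H_k$, $k=1,2,\dots$, are obtained by merging (taking unions of) those components $\tilde T_l$ that are linked by a chain of components with successive $d_\infty$-distances at most $2(\log m)^{-1}$; thus $\bigsqcup_l\tilde T_l=\bigsqcup_k\tilde H_k$ and $d_\infty(\tilde H_k,\tilde H_{k'})>2(\log m)^{-1}$ for all $k\ne k'$. Classifier: for $k\ge1$ let $Z_{n,m}^k=\sum_{i=1}^n(2Y_i-1)\mathbf{1}_{\{X_i\in\tilde H_k\}}$ and $\tilde g_{n,m}^k(x)=\mathbf{1}_{\{Z_{n,m}^k>0\}}$ for $x\in\tilde H_k$. Define $\tilde g_{n,m}(x)=\sum_{k\ge1}\tilde g_{n,m}^k(x)\mathbf{1}_{\{x\in\tilde H_k\}}$ for $x\in\mathcal{X}$ (so it equals $0$ outside $\tilde G_m$). The $\lambda$-thresholded excess-risk is $$\mathcal{E}_\lambda(\tilde g_{n,m})=\mathbb{E}_{n,m}\int_{\Gamma(\lambda)}|2\eta(x)-1|\,\mathbf{1}_{\{\tilde g_{n,m}(x)\ne g^\star(x)\}}\,p(x)\,dx.$$ *)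

(* Defs.v *)
From HB Require Import structures.
From mathcomp Require Import all_boot all_order all_algebra.
From mathcomp Require Import all_classical all_reals all_analysis.
Import Order.TTheory GRing.Theory Num.Theory.
Import numFieldNormedType.Exports.

Set Implicit Arguments.
Unset Strict Implicit.
Unset Printing Implicit Defensive.

Local Open Scope classical_set_scope.
Local Open Scope ring_scope.

Lemma pushforward_sigma_finite d1 d2 (T1 : measurableType d1)
    (T2 : measurableType d2) (R : realType)
    (mu : set T1 -> \bar R) (f : T1 -> T2) (g : T2 -> T1) :
  measurable_fun setT g -> cancel f g ->
  sigma_finite setT mu -> sigma_finite setT (pushforward mu f).
Proof.
move=> mg fK [F FT Fmu].
exists (fun i => g @^-1` F i).
  by rewrite -preimage_bigcup -FT preimage_setT.
move=> i; have [mF muF] := Fmu i; split.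
  by rewrite -[X in measurable X]setTI; exact: mg.
rewrite /pushforward -comp_preimage (_ : g \o f = id) ?preimage_id//.
by apply/funext => x /=; rewrite fK.
Qed.

Lemma product_sigma_finite d1 d2 (T1 : measurableType d1)
    (T2 : measurableType d2) (R : realType)
    (m1 : {sigma_finite_measure set T1 -> \bar R})
    (m2 : {sigma_finite_measure set T2 -> \bar R}) :
  sigma_finite setT (m1 \x m2)%E.
Proof.
have /sigma_finiteP[F [TF ndF Foo]] := sigma_finiteT m1.
have /sigma_finiteP[G [TG ndG Goo]] := sigma_finiteT m2.
exists (fun n => F n `*` G n).
  rewrite -setXTT TF TG predeqE => -[x y]; split.
    move=> [/= [n _ Fnx] [k _ Gky]]; exists (maxn n k) => //; split.
    - by move: x Fnx; exact/subsetPset/ndF/leq_maxl.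
    - by move: y Gky; exact/subsetPset/ndG/leq_maxr.
  by move=> [n _ []/= ? ?]; split; exists n.
move=> k; have [? ?] := Foo k; have [? ?] := Goo k.
split; first exact: measurableX.
by rewrite product_measure1E// lte_mul_pinfty// ge0_fin_numE.
Qed.

Section cons_measure.
Context d (T : measurableType d) (R : realType) (n : nat).
Local Open Scope ereal_scope.

Definition cons_pair (u : T * n.-tuple T) : n.+1.-tuple T :=
  [tuple of u.1 :: u.2].

Let uncons (t : n.+1.-tuple T) : T * n.-tuple T :=
  (tnth t ord0, [tuple of behead t]).

Lemma measurable_cons_pair : measurable_fun setT cons_pair.
Proof. exact: measurable_cons. Qed.

Let measurable_uncons : measurable_fun setT uncons.
Proof.
apply: measurable_fun_pair; first exact: measurable_tnth.
exact: measurable_behead.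
Qed.

Let cons_pairK : cancel cons_pair uncons.
Proof. by move=> [x t]; congr pair => //; exact/val_inj. Qed.

Variables (m : {sigma_finite_measure set T -> \bar R}).
Variable mn : {sigma_finite_measure set (n.-tuple T) -> \bar R}.

Definition cons_measure : set (n.+1.-tuple T) -> \bar R :=
  pushforward (m \x mn) cons_pair.

Let cons_measure0 : cons_measure set0 = 0.
Proof. by rewrite /cons_measure /pushforward preimage_set0 measure0. Qed.

Let cons_measure_ge0 A : 0 <= cons_measure A.
Proof. exact: (measure_ge0 (m \x mn)). Qed.

Let cons_measure_sigma_additive : semi_sigma_additive cons_measure.
Proof.
move=> F mF tF mUF; rewrite /cons_measure /pushforward preimage_bigcup.
apply: (@measure_semi_sigma_additive _ _ _ (m \x mn)).
- by move=> i; rewrite -[X in measurable X]setTI; exact: measurable_cons_pair.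
- apply/trivIsetP => i j _ _ ij; rewrite -preimage_setI.
  by move/trivIsetP : tF => /(_ _ _ _ _ ij) ->//; rewrite preimage_set0.
- rewrite -preimage_bigcup -[X in measurable X]setTI.
  exact: measurable_cons_pair.
Qed.

HB.instance Definition _ := isMeasure.Build _ _ _ cons_measure
  cons_measure0 cons_measure_ge0 cons_measure_sigma_additive.

Let sigma_finite_cons : sigma_finite setT cons_measure.
Proof.
exact: pushforward_sigma_finite measurable_uncons cons_pairK
  (product_sigma_finite m mn).
Qed.

HB.instance Definition _ :=
  Measure_isSigmaFinite.Build _ _ _ cons_measure sigma_finite_cons.

End cons_measure.

(* [measure_power m n] is the n-fold product measure of m; for a probability
   m it is the law of n independent observations drawn from m. *)
Fixpoint measure_power d (T : measurableType d) (R : realType)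
    (m : {sigma_finite_measure set T -> \bar R}) n :
    {sigma_finite_measure set (n.-tuple T) -> \bar R} :=
  match n with
  | 0 => dirac [tuple]
  | n'.+1 => cons_measure m (measure_power m n')
  end.

Lemma measure_power_box d (T : measurableType d) (R : realType)
    (m : {sigma_finite_measure set T -> \bar R}) n (A : 'I_n -> set T) :
  (forall i, measurable (A i)) ->
  (measure_power m n [set t | forall i, A i (tnth t i)] = \prod_(i < n) m (A i))%E.
Proof.
elim: n A => [A _|n IHn A mA].
  rewrite big_ord0 /= diracE mem_set//=.
  by case.
rewrite big_ord_recl -IHn// /= /cons_measure /pushforward.
rewrite (_ : _ @^-1` _ =
    A ord0 `*` [set t | forall i, A (lift ord0 i) (tnth t i)]).
  apply: product_measure1E => //.
  rewrite (_ : [set t | _] = \bigcap_(i in [set: 'I_n])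
      ((fun t : n.-tuple T => tnth t i) @^-1` A (lift ord0 i))).
    apply: fin_bigcap_measurable; first exact: finite_finset.
    by move=> i _; rewrite -[X in measurable X]setTI; exact: measurable_tnth.
  by apply/seteqP; split => t /= At i; first move=> _; exact: At.
apply/seteqP; split => -[x t] /=.
  move=> H; split; first exact: (H ord0).
  by move=> i; have := H (lift ord0 i); rewrite tnthS.
by move=> [Ax At] i; case: (unliftP ord0 i) => [j ->|->//]; rewrite tnthS; exact: At.
Qed.

Section rV_measurable.
Context (R : realType) (d : nat).

Let coord (i : 'I_d) (x : 'rV[R]_d) : R := x ord0 i.

Let rV_set0 : g_sigma_preimage coord set0.
Proof. exact: sigma_algebra0. Qed.

Let rV_setC A : g_sigma_preimage coord A -> g_sigma_preimage coord (~` A).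
Proof. exact: sigma_algebraC. Qed.

Let rV_bigcup (F : _^nat) : (forall i, g_sigma_preimage coord (F i)) ->
  g_sigma_preimage coord (\bigcup_i (F i)).
Proof. exact: sigma_algebra_bigcup. Qed.

(* The sigma-algebra generated by the coordinates, i.e. the Borel sets. *)
HB.instance Definition _ := @isMeasurable.Build default_measure_display
  'rV[R]_d (g_sigma_preimage coord) rV_set0 rV_setC rV_bigcup.

Lemma measurable_coord (i : 'I_d) :
  measurable_fun [set: 'rV[R]_d] (fun x : 'rV[R]_d => x ord0 i).
Proof.
move=> _ Y mY; rewrite setTI; apply: sub_sigma_algebra => /=.
rewrite -bigcup_seq/=; exists i => /=; first by rewrite mem_index_enum.
by exists Y => //; rewrite setTI.
Qed.

End rV_measurable.

Section lebesgue_rV.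
Context (R : realType) (d : nat).
Local Open Scope ereal_scope.

Definition row_of_tuple (t : d.-tuple (measurableTypeR R)) : 'rV[R]_d :=
  (\row_i (tnth t i : R))%R.

Let tuple_of_row (x : 'rV[R]_d) : d.-tuple (measurableTypeR R) :=
  [tuple (x ord0 i : measurableTypeR R) | i < d].

Lemma measurable_row_of_tuple : measurable_fun setT row_of_tuple.
Proof.
move=> _ Y mY; rewrite setTI.
suff : g_sigma_preimage (fun (i : 'I_d) (x : 'rV[R]_d) => x ord0 i) `<=`
    [set A | measurable (row_of_tuple @^-1` A)] by exact.
apply: smallest_sub.
  split => /=.
  - by rewrite preimage_set0.
  - by move=> A mA; rewrite setTD preimage_setC; exact: measurableC.
  - by move=> F mF; rewrite preimage_bigcup; exact: bigcupT_measurable.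
rewrite -bigcup_seq => A [i _ [B mB <-]] /=; rewrite setTI.
rewrite (_ : _ @^-1` _ = (fun t => tnth t i) @^-1` B).
  rewrite -[X in measurable X]setTI; exact: measurable_tnth.
by apply/seteqP; split => t /=; rewrite mxE.
Qed.

Let measurable_tuple_of_row : measurable_fun setT tuple_of_row.
Proof.
apply/measurable_fun_tnthP => i.
rewrite (_ : _ \o _ = fun x : 'rV[R]_d => x ord0 i).
  exact: measurable_coord.
by apply/funext => x /=; rewrite tnth_mktuple.
Qed.

Let row_of_tupleK : cancel row_of_tuple tuple_of_row.
Proof. by move=> t; apply: eq_from_tnth => i; rewrite tnth_mktuple mxE. Qed.

Local Notation lebesgue_tuple := (measure_power (@lebesgue_measure R) d).

Definition lebesgue_rV : set 'rV[R]_d -> \bar R :=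
  pushforward lebesgue_tuple row_of_tuple.

Let lebesgue_rV0 : lebesgue_rV set0 = 0.
Proof. by rewrite /lebesgue_rV /pushforward preimage_set0 measure0. Qed.

Let lebesgue_rV_ge0 A : 0 <= lebesgue_rV A.
Proof. exact: (measure_ge0 lebesgue_tuple). Qed.

Let lebesgue_rV_sigma_additive : semi_sigma_additive lebesgue_rV.
Proof.
move=> F mF tF mUF; rewrite /lebesgue_rV /pushforward preimage_bigcup.
apply: (@measure_semi_sigma_additive _ _ _ lebesgue_tuple).
- move=> i; rewrite -[X in measurable X]setTI.
  exact: measurable_row_of_tuple.
- apply/trivIsetP => i j _ _ ij; rewrite -preimage_setI.
  by move/trivIsetP : tF => /(_ _ _ _ _ ij) ->//; rewrite preimage_set0.
- rewrite -preimage_bigcup -[X in measurable X]setTI.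
  exact: measurable_row_of_tuple.
Qed.

HB.instance Definition _ := isMeasure.Build _ _ _ lebesgue_rV
  lebesgue_rV0 lebesgue_rV_ge0 lebesgue_rV_sigma_additive.

Let sigma_finite_lebesgue_rV : sigma_finite setT lebesgue_rV.
Proof.
exact: pushforward_sigma_finite measurable_tuple_of_row row_of_tupleK
  (sigma_finiteT lebesgue_tuple).
Qed.

HB.instance Definition _ :=
  Measure_isSigmaFinite.Build _ _ _ lebesgue_rV sigma_finite_lebesgue_rV.

Lemma lebesgue_rV_box (A : 'I_d -> set R) : (forall i, measurable (A i)) ->
  lebesgue_rV [set x | forall i, A i (x ord0 i)] =
  \prod_(i < d) lebesgue_measure (A i).
Proof.
move=> mA; rewrite -(measure_power_box (@lebesgue_measure R))//.
rewrite /lebesgue_rV /pushforward; congr (measure_power _ _ _).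
by apply/seteqP; split => t /= At i; have := At i; rewrite mxE.
Qed.

End lebesgue_rV.

Arguments lebesgue_rV {R d}.

Section euclidean.
Context (R : realType) (d : nat).
Implicit Types (C G : set 'rV[R]_d) (x y : 'rV[R]_d) (f : R -> 'rV[R]_d).

(* The norm `|x| of the library on 'rV[R]_d is the sup norm. *)
Definition enorm x : R := Num.sqrt (\sum_(i < d) x ord0 i ^+ 2).

Definition eball x (r : R) : set 'rV[R]_d := [set y | enorm (y - x) <= r].

Definition path_in C x y f : Prop :=
  [/\ {within `[0, 1], continuous f}, f 0 = x, f 1 = y
    & forall t, 0 <= t <= 1 -> C (f t)].

Definition r_connected (c0 r0 : R) C : Prop :=
  forall x y, C x -> C y -> exists2 f, path_in C x y f &
    forall t r, 0 <= t <= 1 -> 0 <= r <= r0 ->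
      ((c0 * r ^+ d)%:E <= lebesgue_rV (eball (f t) r `&` C))%E.

Definition path_component C x : set 'rV[R]_d :=
  [set y | exists f, path_in C x y f].

(* Connected means pathwise connected throughout. *)
Definition components C : set (set 'rV[R]_d) :=
  [set path_component C x | x in C].

Definition d_inf C1 C2 : \bar R :=
  ereal_inf [set (enorm (x - y))%:E | x in C1 & y in C2].

Definition separated_by (s0 : R) (F : set (set 'rV[R]_d)) : Prop :=
  forall C1 C2, F C1 -> F C2 -> C1 <> C2 -> (s0%:E <= d_inf C1 C2)%E.

End euclidean.

(* u_m = \tilde O(v_m).  The bound is required from m = 2 on, because
   log m vanishes at m = 1. *)
Definition soft_bigO (R : realType) (u : nat -> \bar R) (v : nat -> R) : Prop :=
  exists C b : R, [/\ 0 < C, 0 < b & forall m, (1 < m)%N ->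
    (u m <= (C * ln m%:R `^ b * v m)%:E)%E].

HB.instance Definition _ (R : realType) (d : nat) :=
  @isMeasurableFun.Build _ _ _ _ (@fst 'rV[R]_d bool) measurable_fst.

Section model.
Context (R : realType) (d : nat).
Local Notation E := 'rV[R]_d.

(* A label Y in {0, 1} is a boolean; P is the joint law of (X, Y). *)
Context (P : probability (E * bool)%type R).

Definition marginal_X : probability E R := distribution P (@fst E bool).

Definition is_density (p : E -> R) : Prop :=
  forall A, measurable A ->
    marginal_X A = (\int[lebesgue_rV]_(x in A) (p x)%:E)%E.

(* eta(x) = P(Y = 1 | X = x) *)
Definition is_regression (eta : E -> R) : Prop :=
  forall A, measurable A ->
    P (A `*` [set true]) = (\int[marginal_X]_(x in A) (eta x)%:E)%E.

Definition bayes (eta : E -> R) (x : E) : R := (2^-1 <= eta x)%R%:R.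

Definition level_set (X : set E) (p : E -> R) (lam : R) : set E :=
  [set x | X x /\ lam <= p x].

Definition cluster_assumption (eta : E -> R) (Gamma : set E) : Prop :=
  countable (components Gamma) /\
  forall T, components Gamma T ->
    forall x y, T x -> T y -> bayes eta x = bayes eta y.

Definition margin (p eta : E -> R) (T : set E) : R :=
  \int[lebesgue_rV]_(x in T) (`|2 * eta x - 1| * p x).

Definition global_margin_assumption (p eta : E -> R) (Gamma : set E)
    (delta : R) : Prop :=
  0 < delta /\ forall T, components Gamma T ->
    margin p eta T = 0 \/ delta <= margin p eta T.

(* Joint measurability in (sample, point) is what gives a meaning to the
   expected Lebesgue measures of G m u `+` Gamma and G m u `&` ~` Gamma. *)
Definition set_estimator (X : set E) (G : forall m, m.-tuple E -> set E) :=
  forall m, measurable [set z : m.-tuple E * E | G m z.1 z.2] /\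
    forall u, G m u `<=` X.

Definition consistent_from_inside (alpha : R) (Gamma : set E)
    (G : forall m, m.-tuple E -> set E) : Prop :=
  soft_bigO (fun m => \int[measure_power marginal_X m]_u
      lebesgue_rV (G m u `+` Gamma))%E
    (fun m => m%:R `^ (- alpha)) /\
  soft_bigO (fun m => \int[measure_power marginal_X m]_u
      lebesgue_rV (G m u `&` ~` Gamma))%E
    (fun m => m%:R `^ (- (2 * alpha))).

Section clip_and_merge.
Variables (alpha : R) (m : nat).

Definition clip (G : set E) : set E :=
  [set x | G x /\
    (lebesgue_rV (G `&` eball x (ln m%:R)^-1)
      <= ((ln m%:R)^-1 ^+ d / m%:R `^ alpha)%:E)%E].

Definition clipped (G : set E) : set E := G `\` clip G.

Definition linked (G T T' : set E) : Prop :=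
  exists k (c : nat -> set E),
    [/\ c 0%N = T, c k = T', (forall i, (i <= k)%N -> components G (c i)) &
      forall i, (i < k)%N -> (d_inf (c i) (c i.+1) <= (2 * (ln m%:R)^-1)%:E)%E].

Definition merged (G : set E) : set (set E) :=
  [set \bigcup_(T' in linked G T) T' | T in components G].

End clip_and_merge.

Definition vote n (l : n.-tuple (E * bool)) (H : set E) : R :=
  \sum_(i < n) (2 * (tnth l i).2%:R - 1) * (\1_H (tnth l i).1 : R).

(* The merged sets are pairwise disjoint, so the sum over H has at most one
   nonzero term. *)
Definition classifier (alpha : R) (G : forall m, m.-tuple E -> set E) n m
    (l : n.-tuple (E * bool)) (u : m.-tuple E) (x : E) : R :=
  \sum_(H \in merged m (clipped alpha m (G m u)))
    (0 < vote l H)%R%:R * (\1_H x : R).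

(* The expectation is over independent labeled and unlabeled samples.
   Path components of a Borel set need not be Borel, so the integrand is not
   assumed measurable; the integral of a nonnegative function is the supremum
   of the integrals of the simple functions below it. *)
Definition thresholded_risk (p eta : E -> R) (Gamma : set E) n m
    (g : n.-tuple (E * bool) -> m.-tuple E -> E -> R) : \bar R :=
  (\int[measure_power P n \x measure_power marginal_X m]_z
    \int[lebesgue_rV]_(x in Gamma)
      (`|2 * eta x - 1| * (g z.1 z.2 x != bayes eta x)%:R * p x)%:E)%E.

End model.

(* Main.v *)
Require Import Defs.
From mathcomp Require Import all_boot all_order all_algebra.
From mathcomp Require Import all_classical all_reals all_analysis.
From mathcomp Require Import measurable_realfun.
From mathcomp Require Import ring lra.
Import Order.TTheory GRing.Theory Num.Theory.
Import numFieldNormedType.Exports.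

Set Implicit Arguments.
Unset Strict Implicit.
Unset Printing Implicit Defensive.

Local Open Scope classical_set_scope.
Local Open Scope ring_scope.

(** Why the bound holds.  Write [r = (ln m)^-1], [G] for the estimate computed
    from the unlabeled sample and [Gt] for [G] after clipping.

    Fix the unlabeled sample.  If every point of [Gt] is [r]-close to [Gamma] and
    every point of [Gamma] is [r / 2]-close to [Gt], then merging recovers the
    clusters: the merged sets are exactly the sets [N T] of points of [Gt] that
    are [r]-close to a component [T] of [Gamma] ([merged_trace_near]).  Chains
    with jumps at most [2 * r] cannot cross the gap between two components, and
    a path inside [T] is shadowed by such a chain.  All the points of [T] in [Gt]
    then receive the label elected by the vote over [N T], so that the risk is at
    most the mass of [Gamma] outside of [Gt] plus the sum over [T] of [delta_T]
    times the probability of a wrong vote ([conditional_risk_le]).  The mean of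
    one vote differs from [delta_T], up to the sign given by the Bayes label, by
    at most an error [e_T] proportional to the measure of the symmetric
    difference of [T] and [N T].  When [e_T <= (1 - theta) delta_T] the mean is
    at least [theta delta_T] and Chernoff's bound gives the exponential term;
    otherwise [delta_T] itself is at most [e_T / (1 - theta)]
    ([wrong_vote_le]).  The [e_T] add up to at most a constant times the measure
    of the symmetric difference of [Gt] and [Gamma].

    If the two closeness conditions fail, one of the two errors is large: a point
    of [Gt] far from [Gamma] has survived clipping, hence forces
    [r ^+ d / m `^ alpha] of mass of [G] outside of [Gamma]; a point of [Gamma]
    far from [Gt] forces a mass [c0 * (r / 2) ^+ d] of [Gamma] outside of [Gt],
    by [r0]-connectedness.  As the risk never exceeds one, it is bounded in these
    cases by the corresponding error divided by its threshold
    ([risk_given_unlabeled]); taking expectations turns this into Markov's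
    inequality, and consistency from inside, with its faster rate for the excess
    [G] minus [Gamma], yields the rate [m `^ - alpha] up to powers of [ln m].
    Clipping removes from [Gamma] only a mass of order [m `^ - alpha]
    ([clip_measure_le]).

    Measurability needs care.  Path components, hence merged sets, have no
    evident measurable description, but here they are at a positive distance from
    the rest of the set they are cut from, which makes them Borel for each fixed
    unlabeled sample ([separated_measurable]).  Nothing similar holds jointly in
    the two samples; the risk is an integral from below, and for such integrals
    monotonicity and one inequality of Tonelli's theorem survive
    ([lower_fubini]), which is the direction required here. *)

(** * Integrals of nonnegative functions that need not be measurable *)

Section lower_integral.
Local Open Scope ereal_scope.
Import HBNNSimple.

Lemma ge0_le_lower_integral d (T : measurableType d) (R : realType)
    (mu : {measure set T -> \bar R}) (D : set T) (f g : T -> \bar R) :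
  (forall x, D x -> 0 <= f x) -> (forall x, D x -> f x <= g x) ->
  \int[mu]_(x in D) f x <= \int[mu]_(x in D) g x.
Proof.
move=> f0 fg.
have g0 x : D x -> 0 <= g x by move=> Dx; rewrite (le_trans (f0 _ Dx)) ?fg.
rewrite !ge0_integralE//; apply: ereal_sup_le => _ [h hf <-].
exists h => // x; apply: (le_trans (hf x)); rewrite !patchE.
by case: ifPn => // /set_mem; exact: fg.
Qed.

(** For an arbitrary nonnegative function the integral is the supremum of the
    integrals of the simple functions below it.  Tonelli's theorem applies to
    each of these, and the iterated integral only increases when the simple
    function is replaced by [f]. *)
Lemma lower_fubini d1 d2 (T1 : measurableType d1) (T2 : measurableType d2)
    (R : realType) (m1 : {sigma_finite_measure set T1 -> \bar R})
    (m2 : {sigma_finite_measure set T2 -> \bar R}) (f : T1 * T2 -> \bar R) :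
  (forall z, 0 <= f z) ->
  \int[m1 \x m2]_z f z <= \int[m2]_y \int[m1]_x f (x, y).
Proof.
move=> f0; rewrite ge0_integralTE//; apply: ge_ereal_sup => _ [h hf <-].
rewrite -integralT_nnsfun fubini_tonelli2//; last 2 first.
- exact/measurable_EFinP.
- by move=> z; rewrite lee_fin fun_ge0.
apply: ge0_le_lower_integral => y _; last apply: ge0_le_lower_integral => x _.
- by apply: integral_ge0 => x _; rewrite lee_fin fun_ge0.
- by rewrite lee_fin fun_ge0.
- exact: hf.
Qed.

End lower_integral.

(** * Euclidean distance and separated sets *)

Section euclidean_norm.
Context (R : realType) (d : nat).
Implicit Types (x y z : 'rV[R]_d) (r : R).

Let sqs x : R := \sum_(i < d) x ord0 i ^+ 2.

Let sqs_ge0 x : 0 <= sqs x.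
Proof. by apply: sumr_ge0 => i _; exact: sqr_ge0. Qed.

Lemma enorm_ge0 x : 0 <= enorm x.
Proof. exact: sqrtr_ge0. Qed.

Lemma enorm0 : enorm (0 : 'rV[R]_d) = 0.
Proof.
rewrite /enorm big1 ?sqrtr0// => i _.
by rewrite mxE expr0n.
Qed.

Lemma enormN x : enorm (- x) = enorm x.
Proof.
by congr Num.sqrt; apply: eq_bigr => i _; rewrite mxE sqrrN.
Qed.

Lemma enormB x y : enorm (x - y) = enorm (y - x).
Proof. by rewrite -enormN opprB. Qed.

(** The Cauchy-Schwarz inequality is the nonnegativity of the double sum of
    the squares [(x_i y_j - x_j y_i) ^+ 2]. *)
Lemma sum_mul_enorm x y :
  \sum_(i < d) x ord0 i * y ord0 i <= enorm x * enorm y.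
Proof.
set S := \sum_(i < d) _.
have /le_trans -> // : S <= `|S| by exact: ler_norm.
rewrite -ler_sqr ?nnegrE ?mulr_ge0 ?enorm_ge0 // exprMn !sqr_sqrtr ?sqs_ge0 //.
rewrite real_normK ?num_real// -subr_ge0.
have : 0 <= \sum_(i < d) \sum_(j < d)
    (x ord0 i * y ord0 j - x ord0 j * y ord0 i) ^+ 2.
  by apply: sumr_ge0 => i _; apply: sumr_ge0 => j _; exact: sqr_ge0.
have -> : \sum_(i < d) \sum_(j < d)
    (x ord0 i * y ord0 j - x ord0 j * y ord0 i) ^+ 2 =
    2 * (sqs x * sqs y - S ^+ 2).
  transitivity (\sum_(i < d) \sum_(j < d)
      ((x ord0 i ^+ 2 * y ord0 j ^+ 2 + x ord0 j ^+ 2 * y ord0 i ^+ 2)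
       - 2 * ((x ord0 i * y ord0 i) * (x ord0 j * y ord0 j)))).
    by apply: eq_bigr => i _; apply: eq_bigr => j _; ring.
  under eq_bigr do rewrite sumrB big_split/= -mulr_sumr -mulr_suml -!mulr_sumr.
  rewrite sumrB big_split/= -mulr_suml -mulr_sumr -[in X in _ - X]mulr_sumr.
  by rewrite -mulr_suml -/(sqs x) -/(sqs y) -/S; ring.
by rewrite pmulr_rge0.
Qed.

Lemma enormD x y : enorm (x + y) <= enorm x + enorm y.
Proof.
rewrite -ler_sqr ?nnegrE ?addr_ge0 ?enorm_ge0 // sqrrD !sqr_sqrtr ?sqs_ge0 //.
rewrite [leLHS](_ : _ = sqs x + (\sum_(i < d) x ord0 i * y ord0 i) *+ 2 + sqs y).
  by rewrite lerD2r lerD2l lerMn2r/= sum_mul_enorm.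
rewrite -sumrMnl -!big_split/=.
by apply: eq_bigr => i _; rewrite mxE; ring.
Qed.

Lemma enorm_triangle y x z : enorm (x - z) <= enorm (x - y) + enorm (y - z).
Proof. by have := enormD (x - y) (y - z); rewrite addrA subrK. Qed.

Lemma enorm_le_coord x r :
  (forall i, `|x ord0 i| <= r) -> enorm x <= d%:R * r.
Proof.
move=> xr; case: (posnP d) => [d0|d_gt0].
  rewrite [enorm x](_ : _ = 0); first by rewrite d0 mul0r.
  rewrite /enorm big1 ?sqrtr0 // => -[i hi] _; exfalso.
  by move: hi; rewrite {1}d0.
have r0 : 0 <= r := le_trans (normr_ge0 _) (xr (Ordinal d_gt0)).
rewrite -ler_sqr ?nnegrE ?mulr_ge0 ?enorm_ge0 // sqr_sqrtr ?sqs_ge0 //.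
apply: (@le_trans _ _ (\sum_(i < d) r ^+ 2)).
  by apply: ler_sum => i _; rewrite -real_normK ?num_real// ler_sqr ?nnegrE.
rewrite sumr_const card_ord -[X in X <= _]mulr_natl exprMn ler_wpM2r ?sqr_ge0 //.
by rewrite expr2 ler_peMr // ler1n.
Qed.

Lemma measurable_enormB d' (T : measurableType d') (f g : T -> 'rV[R]_d) :
  measurable_fun setT f -> measurable_fun setT g ->
  measurable_fun setT (fun t => enorm (f t - g t)).
Proof.
move=> mf mg; rewrite /enorm.
apply: (measurableT_comp (f := @Num.sqrt R)).
  by apply: continuous_measurable_fun; exact: sqrt_continuous.
apply: measurable_sum => i; apply: measurable_funX.
rewrite [X in measurable_fun _ X](_ : _ = fun t => f t ord0 i - g t ord0 i).
  by apply: measurable_funB; apply: (measurableT_comp (measurable_coord i)).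
by apply/funext => t; rewrite !mxE.
Qed.

Lemma measurable_enorm_le d' (T : measurableType d') (f g : T -> 'rV[R]_d) r :
  measurable_fun setT f -> measurable_fun setT g ->
  measurable [set t | enorm (f t - g t) <= r].
Proof.
move=> mf mg.
have := measurable_enormB mf mg measurableT (measurable_itv `]-oo, r]).
by rewrite setTI; congr measurable; apply/seteqP; split => t /=; rewrite in_itv.
Qed.

Lemma measurable_eball x r : measurable (eball x r).
Proof. exact: measurable_enorm_le. Qed.

Lemma exists_rat_near x r : 0 < r ->
  exists q : 'rV[rat]_d, enorm (map_mx ratr q - x) <= r.
Proof.
move=> r0; pose e := r / (d%:R + 1).
have e0 : 0 < e by rewrite divr_gt0 // ltr_wpDl.
have /choice[q qP] i : exists q : rat, `|ratr q - x ord0 i| <= e.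
  have /rat_in_itvoo[q] : x ord0 i < x ord0 i + e by rewrite ltrDl.
  rewrite in_itv/= => /andP[/ltW xq qx]; exists q.
  by rewrite ger0_norm ?subr_ge0 // lerBlDl ltW.
exists (\row_i q i); apply: (@le_trans _ _ (d%:R * e)).
  by apply: enorm_le_coord => i; rewrite !mxE.
rewrite /e mulrCA ler_piMr ?(ltW r0) // ler_pdivrMr ?ltr_wpDl //.
by rewrite mul1r lerDl.
Qed.

(** A set at positive distance from its complement in [M] is the trace on [M]
    of a countable union of balls with rational centres. *)
Lemma separated_measurable (M A : set 'rV[R]_d) (e : R) : 0 < e ->
  measurable M -> A `<=` M ->
  (forall x y, A x -> M y -> ~ A y -> e <= enorm (x - y)) -> measurable A.
Proof.
move=> e0 mM AM Ae.
have e3 : 0 < e / 3 by rewrite divr_gt0.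
pose near_A (q : 'rV[rat]_d) := exists2 x, A x & enorm (map_mx ratr q - x) <= e / 3.
rewrite (_ : A = M `&` \bigcup_(q in near_A) eball (map_mx ratr q) (e / 3)).
  apply: measurableI => //; rewrite bigcup_mkcond.
  apply: countable_bigcupT_measurable => // q.
  by case: ifP => // _; exact: measurable_eball.
apply/seteqP; split => [x Ax|y [My [q [x Ax qx] qy]]].
  split; first exact: AM.
  have [q qx] := exists_rat_near x e3.
  by exists q; [exists x | rewrite /eball/= enormB].
apply: contrapT => nAy; have := Ae _ _ Ax My nAy; apply/negP; rewrite -ltNge.
have := enorm_triangle (map_mx ratr q) x y.
move: qx (qy : enorm (y - map_mx ratr q) <= e / 3) => {}qx {}qy.
rewrite (enormB _ x) in qx; rewrite (enormB y) in qy => h.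
by apply: (le_lt_trans h); lra.
Qed.

End euclidean_norm.

(** * Paths, chains and merged components *)

Section paths.
Context (R : realType) (d : nat).
Implicit Types (C : set 'rV[R]_d) (x y z : 'rV[R]_d) (f : R -> 'rV[R]_d).

(** Uniform continuity on the compact interval, in the discrete form in which
    paths are compared with chains of components. *)
Lemma path_fine_steps f (e : R) : 0 < e -> {within `[0, 1], continuous f} ->
  exists2 N, (0 < N)%N & forall i, (i < N)%N ->
    enorm (f (i%:R / N%:R) - f (i.+1%:R / N%:R)) <= e.
Proof.
move=> e0 /subspace_continuousP cf.
pose P (N : nat) t := forall s, 0 <= s <= 1 -> `|t - s| <= N.+1%:R^-1 ->
  enorm (f t - f s) <= e.
have : near_covering_within (`[0, 1]%classic : set R).
  by apply/near_covering_withinP/compact_near_coveringP/segment_compact.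
move=> /(_ nat \oo P _) ncov.
have [N _ /(_ N (leqnn N)) PN] : \forall N \near \oo, (`[0, 1]%classic : set R) `<=` P N.
  apply: ncov => t0 t0I.

  pose e1 := e / 2 / (d%:R + 1).
  have e10 : 0 < e1 by rewrite !divr_gt0 // ltr_wpDl.
  have /cvg_ballP/(_ e1 e10) := cf t0 t0I.
  rewrite near_withinE => /nbhs_ballP[r /= r0 rP].
  have near_t0 s : 0 <= s <= 1 -> `|t0 - s| < r -> enorm (f t0 - f s) <= e / 2.
    move=> s01 ts; apply: (@le_trans _ _ (d%:R * e1)).
      apply: enorm_le_coord => i; rewrite !mxE; apply: ltW.
      by have [|_] := rP s ts; [rewrite /= in_itv | move/(_ ord0 i)].
    rewrite /e1 mulrCA ler_piMr ?divr_ge0 ?(ltW e0) //.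
    by rewrite ler_pdivrMr ?mul1r ?lerDl // ltr_wpDl.
  have r2 : 0 < r / 2 by rewrite divr_gt0.
  near=> t N => /=; rewrite in_itv/= => t01 s s01 ts.
  have t0t : `|t0 - t| < r / 2.
    by near: t; exact: (@nbhsx_ballx _ _ t0 _ r2).
  have N_small : N.+1%:R^-1 < r / 2.
    by near: N; exact: (near_infty_natSinv_lt (PosNum r2)).
  rewrite (le_trans (enorm_triangle (f t0) _ _)) // [leRHS](splitr e) lerD//.
    rewrite enormB near_t0// (lt_trans t0t)//; lra.
  rewrite near_t0// [ltRHS](splitr r) (le_lt_trans (ler_distD t _ _))//.
  by rewrite ltrD// (le_lt_trans ts).
exists N.+1 => // i iN; apply: PN.
- rewrite /= in_itv/= divr_ge0//= ler_pdivrMr// mul1r ler_nat.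
    exact: ltnW.
- by rewrite divr_ge0//= ler_pdivrMr// mul1r ler_nat.
- by rewrite -mulrBl -natr1 opprD addrA subrr sub0r mulN1r normrN ger0_norm.
Unshelve. all: by end_near. Qed.

Lemma path_component_center C x : C x -> path_component C x x.
Proof.
move=> Cx; exists (fun=> x); split=> //.
by apply: continuous_subspaceT; exact: cst_continuous.
Qed.

Lemma component_cover C x : C x -> exists2 T, components C T & T x.
Proof.
by move=> Cx; exists (path_component C x); [exists x | exact: path_component_center].
Qed.

Lemma component_sub C T : components C T -> T `<=` C.
Proof.
move=> [x _ <-] y [f [_ _ <- Cf]]; apply: Cf.
by rewrite ler01 lexx.
Qed.

Lemma separated_components (s : R) C T T' x y : separated_by s (components C) ->
  components C T -> components C T' -> T x -> T' y -> T <> T' ->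
  s <= enorm (x - y).
Proof.
move=> sepC CT CT' Tx T'y TT'; rewrite -lee_fin (le_trans (sepC _ _ CT CT' TT'))//.
by apply: ereal_inf_lbound; exists x => //; exists y.
Qed.

End paths.

Section merged_components.
Context (R : realType) (d m : nat) (Gt Gamma : set 'rV[R]_d) (r s : R).
Implicit Types (T H : set 'rV[R]_d) (x y z : 'rV[R]_d).
Hypotheses (rE : (ln m%:R)^-1 = r) (r0 : 0 < r) (rs : 4 * r < s).
Hypothesis sepGamma : separated_by s (components Gamma).
Hypothesis pathGamma : forall T, components Gamma T -> forall x y, T x -> T y ->
  exists f, path_in T x y f.
Hypothesis Gt_near : forall x, Gt x -> exists2 y, Gamma y & enorm (x - y) <= r.
Hypothesis Gamma_near : forall y, Gamma y ->
  exists2 x, Gt x & enorm (y - x) <= r / 2.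

Definition trace_near T := [set x | Gt x /\ exists2 y, T y & enorm (x - y) <= r].

Lemma trace_near_cover x : Gt x ->
  exists2 T, components Gamma T & trace_near T x.
Proof.
move=> Gx; have [y Gy xy] := Gt_near Gx.
by have [T CT Ty] := component_cover Gy; exists T => //; split=> //; exists y.
Qed.

Lemma trace_near_separated T T' x y : components Gamma T -> components Gamma T' ->
  trace_near T x -> trace_near T' y -> T <> T' -> s - 2 * r <= enorm (x - y).
Proof.
have [r_gt0 r_lt] := conj r0 rs.
move=> CT CT' [_ [x1 Tx1 xx1]] [_ [y1 Ty1 yy1]] TT'.
have h := separated_components sepGamma CT CT' Tx1 Ty1 TT'.
have h1 := enorm_triangle x x1 y1; have h2 := enorm_triangle y x y1.
rewrite (enormB x1 x) in h1; lra.
Qed.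

Lemma trace_near_close T T' x y : components Gamma T -> components Gamma T' ->
  trace_near T x -> trace_near T' y -> enorm (x - y) <= 2 * r -> T = T'.
Proof.
have [r_gt0 r_lt] := conj r0 rs.
move=> CT CT' Tx T'y xy; apply: contrapT => TT'.
have := trace_near_separated CT CT' Tx T'y TT'; apply/negP; rewrite -ltNge; lra.
Qed.

Lemma trace_near_inj T T' x : components Gamma T -> components Gamma T' ->
  trace_near T x -> trace_near T' x -> T = T'.
Proof.
have [r_gt0 r_lt] := conj r0 rs.
move=> CT CT' Tx T'x; apply: (trace_near_close CT CT' Tx T'x).
by rewrite subrr enorm0; lra.
Qed.

(** The steps of a fine subdivision of the path are shorter than the gap between
    the sets [trace_near T] of two different components. *)
Lemma trace_near_path T x y f : components Gamma T ->
  path_in Gt x y f -> trace_near T x -> trace_near T y.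
Proof.
have [r_gt0 r_lt] := conj r0 rs.
move=> CT [cf f0 f1 Gf] Tx; have [N N0 fN] := path_fine_steps r0 cf.
suff fi i : (i <= N)%N -> trace_near T (f (i%:R / N%:R)).
  by have := fi N (leqnn N); rewrite divff ?pnatr_eq0 -?lt0n// f1.
elim: i => [_|i IHi iN]; first by rewrite mul0r f0.
have Gfi : Gt (f (i.+1%:R / N%:R)).
  by apply: Gf; rewrite divr_ge0//= ler_pdivrMr ?ltr0n// mul1r ler_nat.
have [T' CT' T'f] := trace_near_cover Gfi.
rewrite (trace_near_close CT CT' (IHi (ltnW iN)) T'f)// (le_trans (fN i iN))//.
lra.
Qed.

Lemma component_trace_near T K x : components Gamma T -> components Gt K ->
  K x -> trace_near T x -> K `<=` trace_near T.
Proof.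
move=> CT [z Gz <-] [f xf] Tx y [g yg].
have [T' CT' T'z] := trace_near_cover Gz.
rewrite (trace_near_inj CT CT' Tx (trace_near_path CT' xf T'z)).
exact: trace_near_path yg T'z.
Qed.

(** Consecutive members of a chain are within [2 * r], which is less than the
    gap [s - 2 * r] between the sets [trace_near T] of different components. *)
Lemma linked_trace_near T K K' x : components Gamma T -> K x -> trace_near T x ->
  linked m Gt K K' -> K' `<=` trace_near T.
Proof.
have [r_gt0 r_lt] := conj r0 rs.
move=> CT Kx Tx [k [c [c0 <- Kc dc]]].
suff ci i : (i <= k)%N -> c i `<=` trace_near T by exact: ci.
elim: i => [_|i IHi ik].
  by apply: component_trace_near CT (Kc _ _) _ Tx => //; rewrite c0.
have [z Gz cz] := Kc _ ik; have [T' CT' T'z] := trace_near_cover Gz.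
have cT' : c i.+1 `<=` trace_near T'.
  apply: component_trace_near CT' (Kc _ ik) _ T'z; rewrite -cz.
  exact: path_component_center.
suff -> : T = T' by [].
apply: contrapT => TT'; have := dc i ik; apply/negP; rewrite rE -ltNge.
apply: (@lt_le_trans _ _ (s - 2 * r)%:E); first by rewrite lte_fin; lra.
apply: le_ereal_inf_tmp => _ [x1 cx1 [y1 cy1 <-]]; rewrite lee_fin.
by apply: trace_near_separated CT CT' _ _ TT'; [exact: IHi (ltnW ik) _ cx1|exact: cT'].
Qed.

(** The chain follows a path of [T] between points close to [x] and [y]: each
    point of a fine subdivision is replaced by a point of [Gt] at distance at
    most [r / 2], so that jumps have length at most [r / 2 + r + r / 2]. *)
Lemma trace_near_linked T x y : components Gamma T ->
  trace_near T x -> trace_near T y ->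
  linked m Gt (path_component Gt x) (path_component Gt y).
Proof.
have [r_gt0 r_lt] := conj r0 rs.
move=> CT [Gx [x1 Tx1 xx1]] [Gy [y1 Ty1 yy1]].
have [f [cf f0 f1 Tf]] := pathGamma CT Tx1 Ty1.
have [N N0 fN] := path_fine_steps r0 cf.
have /choice[w wP] (i : nat) : exists w, (i <= N)%N ->
    Gt w /\ enorm (f (i%:R / N%:R) - w) <= r / 2.
  case: (leqP i N) => [iN|_]; last by exists 0.
  have /Gamma_near[w Gw fw] : Gamma (f (i%:R / N%:R)); last by exists w.
  apply/(component_sub CT)/Tf.
  by rewrite divr_ge0//= ler_pdivrMr ?ltr0n// mul1r ler_nat.
(* [v] lists the centres of the chain: [x], the shadows of the path, [y]. *)
pose v i := if i is i'.+1 then (if (i' <= N)%N then w i' else y) else x.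
exists N.+2, (fun i => path_component Gt (v i)); split => //=.
- by rewrite ltnn.
- move=> [|i] _; first by exists x.
  by exists (v i.+1) => //=; case: leqP => // /wP[].
have dle a b : Gt a -> Gt b -> enorm (a - b) <= 2 * r ->
    (d_inf (path_component Gt a) (path_component Gt b) <= (2 * r)%:E)%E.
  move=> Ga Gb ab; apply: ge_ereal_inf; exists (enorm (a - b))%:E => //.
  exists a; first exact: path_component_center.
  by exists b => //; exact: path_component_center.
move=> [|i] iN; rewrite rE.
  have [Gw0 xw0] := wP 0%N (leq0n _); rewrite mul0r f0 in xw0.
  apply: dle => //=; have := enorm_triangle x1 x (w 0%N); lra.
have {}iN : (i <= N)%N by [].
rewrite /= iN; have [Gwi wi] := wP i iN.
case: (ltnP i N) => [iN'|Ni].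
  have [Gwi1 wi1] := wP i.+1 iN'; apply: dle => //.
  have h1 := enorm_triangle (f (i%:R / N%:R)) (w i) (w i.+1).
  have h2 := enorm_triangle (f (i.+1%:R / N%:R)) (f (i%:R / N%:R)) (w i.+1).
  have := fN i iN'; rewrite (enormB (w i) (f _)) in h1; lra.
have iE : i = N by apply/eqP; rewrite eqn_leq iN.
move: wi; rewrite iE divff ?pnatr_eq0 -?lt0n// f1 => wi.
apply: dle => //; first by rewrite -iE.
have := enorm_triangle y1 (w N) y; rewrite (enormB (w N) y1) (enormB y1 y); lra.
Qed.

(** Merging recovers the components of [Gamma]: [linked_trace_near] and
    [trace_near_linked] are the two inclusions, both applied to the centre of the
    component of [Gt] from which the merged set is built. *)
Lemma merged_trace_near T H x : components Gamma T ->
  merged m Gt H -> H x -> trace_near T x -> H = trace_near T.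
Proof.
move=> CT [_ [z Gz <-] <-] [K zK Kx] Tx.
have [T' CT' T'z] := trace_near_cover Gz.
have zz := path_component_center Gz.
have KT' := linked_trace_near CT' zz T'z zK.
rewrite (trace_near_inj CT CT' Tx (KT' _ Kx)).
apply/seteqP; split=> [y [K' zK' K'y]|y T'y].
  exact: linked_trace_near CT' zz T'z zK' _ K'y.
exists (path_component Gt y); first exact: trace_near_linked CT' T'z T'y.
by apply: path_component_center; case: T'y.
Qed.

Lemma trace_near_merged T x : components Gamma T -> trace_near T x ->
  merged m Gt (trace_near T).
Proof.
move=> CT Tx; have [Gx _] := Tx; pose K := path_component Gt x.
have KH : merged m Gt (\bigcup_(K' in linked m Gt K) K').
  by exists K => //; exists x.
rewrite -(merged_trace_near CT KH _ Tx) //.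
exists K; last exact: path_component_center.
by exists 0%N, (fun=> K); split => // i _; exists x.
Qed.

Lemma merged_sumE (v : set 'rV[R]_d -> R) T x :
  components Gamma T -> trace_near T x ->
  \sum_(H \in merged m Gt) v H * (\1_H x : R) = v (trace_near T).
Proof.
move=> CT Tx; rewrite -(fsbig_widen [set trace_near T]); last 2 first.
- by move=> _ ->; exact: trace_near_merged Tx.
- move=> H [mH HT]; rewrite /= indicE memNset ?mulr0// => Hx.
  by apply: HT; exact: merged_trace_near Tx.
by rewrite fsbig_set1 indicE mem_set ?mulr1.
Qed.

Lemma measurable_trace_near T : measurable Gt -> components Gamma T ->
  measurable (trace_near T).
Proof.
have [r_gt0 r_lt] := conj r0 rs.
move=> mG CT; apply: (@separated_measurable _ _ Gt _ (s - 2 * r)) => //.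
- lra.
- by move=> x [].
- move=> x y Tx Gy nTy; have [T' CT' T'y] := trace_near_cover Gy.
  apply: (trace_near_separated CT CT' Tx T'y) => TT'.
  by apply: nTy; rewrite TT'.
Qed.

Lemma trace_near_Gamma T : components Gamma T ->
  trace_near T `&` Gamma = T `&` Gt.
Proof.
have [r_gt0 r_lt] := conj r0 rs.
move=> CT; apply/seteqP; split=> x.
  move=> [[Gx [y Ty xy]] Gax]; split=> //.
  have [T' CT' T'x] := component_cover Gax; suff -> : T = T' by [].
  apply: contrapT => TT'; rewrite enormB in xy.
  have := separated_components sepGamma CT CT' Ty T'x TT'.
  by apply/negP; rewrite -ltNge; lra.
move=> [Tx Gx]; split; last exact: (component_sub CT Tx).
by split=> //; exists x => //; rewrite subrr enorm0; exact: ltW.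
Qed.

End merged_components.

(** * Deviation of a majority vote *)

Section chernoff.
Context (R : realType).

(** This is twice [E exp(- t xi) <= exp(- t ^+ 2 / 2)] for a random sign [xi] of
    mean [t].  After multiplication by [exp(t ^+ 2 / 2)] the left-hand side has
    derivative [- t ^+ 2 (exp(t ^+ 2 / 2 + t) - exp(t ^+ 2 / 2 - t))], so it
    decreases from its value at [0], which is [2]. *)
Lemma sign_mgf_le (t : R) : 0 <= t ->
  expR t * (1 - t) + expR (- t) * (1 + t) <= 2 * expR (- (t ^+ 2 / 2)).
Proof.
move=> t0.
pose h (x : R) := expR (x ^+ 2 / 2 + x) * (1 - x) + expR (x ^+ 2 / 2 - x) * (1 + x).
pose dh (x : R) := - x ^+ 2 * (expR (x ^+ 2 / 2 + x) - expR (x ^+ 2 / 2 - x)).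
have dhP (x : R) : is_derive x 1 h (dh x).
  rewrite /h; apply: is_derive_eq.
  by rewrite /dh /GRing.scale/=; field.
suff : h t <= h 0.
  have -> : h 0 = 2 by rewrite /h expr0n/= mul0r !addr0 !subr0 expR0 !mulr1.
  move=> ht; have e := expR_gt0 (t ^+ 2 / 2).
  rewrite -(ler_pM2l e).
  rewrite [leLHS](_ : _ = h t); last by rewrite /h !expRD; ring.
  by rewrite mulrCA -expRD subrr expR0 mulr1.
have ch : {within `[0, t], continuous h}.
  apply: continuous_subspaceT => x; apply: differentiable_continuous.
  by apply/derivable1_diffP; case: (dhP x).
have [x] := @MVT_segment R h dh 0 t t0 (fun x _ => dhP x) ch.
rewrite in_itv/= subr0 => /andP[x0 _] ht; rewrite -subr_le0 ht.
rewrite /dh mulNr mulNr oppr_le0 !mulr_ge0 ?sqr_ge0// subr_ge0 ler_expR.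
by rewrite lerD2l; lra.
Qed.

Lemma measurable_prod_tnth d (T : measurableType d) n (f : T -> R) :
  measurable_fun setT f ->
  measurable_fun setT (fun t : n.-tuple T => \prod_(i < n) f (tnth t i)).
Proof.
move=> mf; apply: measurable_prod => i _.
exact: (measurableT_comp mf (measurable_tnth i)).
Qed.

Lemma measure_power_setT d (T : measurableType d) (P : probability T R) n :
  measure_power P n setT = 1%E.
Proof.
have := @measure_power_box _ _ _ P n (fun=> setT) (fun=> measurableT).
rewrite big1 => [<-|i _]; last exact: probability_setT.
by congr (measure_power _ _ _); apply/seteqP; split.
Qed.

Lemma integral_measure_power_prod d (T : measurableType d)
    (m : {sigma_finite_measure set T -> \bar R}) n (f : T -> R) (c : R) :
  measurable_fun setT f -> (forall x, 0 <= f x) ->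
  (\int[m]_x (f x)%:E = c%:E)%E ->
  (\int[measure_power m n]_t (\prod_(i < n) f (tnth t i))%:E = (c ^+ n)%:E)%E.
Proof.
move=> mf f0 fc.
have c0 : 0 <= c by rewrite -lee_fin -fc integral_ge0// => x _; rewrite lee_fin.
have prod0 k (t : k.-tuple T) : (0 <= (\prod_(i < k) f (tnth t i))%:E)%E.
  by rewrite lee_fin; exact: prodr_ge0.
have mprod k : measurable_fun setT
    (fun t : k.-tuple T => (\prod_(i < k) f (tnth t i))%:E).
  by apply/measurable_EFinP; exact: measurable_prod_tnth.
elim: n => [|n IHn] /=.
  rewrite [LHS](@integral_dirac _ _ ([tuple] : 0.-tuple T) R setT measurableT)//.
    by rewrite diracT mul1e big_ord0 expr0.
  exact: mprod.
rewrite [LHS](@ge0_integral_pushforward _ _ _ _ R (@cons_pair _ T n)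
  (@measurable_cons_pair _ T n) (m \x measure_power m n)%E setT)//; last 2 first.
  exact: (mprod n.+1).
  by move=> t _; exact: prod0.
rewrite preimage_setT fubini_tonelli1/=; last 2 first.
- exact: (measurableT_comp (mprod n.+1) (@measurable_cons_pair _ T n)).
- by move=> z; exact: prod0.
rewrite /fubini_F/=.
transitivity (\int[m]_x ((f x)%:E * (c ^+ n)%:E))%E.
  apply: eq_integral => x _; rewrite -IHn -ge0_integralZl//; last 2 first.
  - exact: (mprod n).
  - by rewrite lee_fin.
  apply: eq_integral => t _; rewrite big_ord_recl EFinM; congr (_ * _)%E.
  by congr EFin; apply: eq_bigr => i _; rewrite tnthS.
rewrite (@ge0_integralZr _ _ _ m setT measurableT (fun x => (f x)%:E))//.
- by rewrite fc -EFinM exprS.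
- exact/measurable_EFinP.
- by move=> x _; rewrite lee_fin.
- by rewrite lee_fin exprn_ge0.
Qed.

Lemma measurable_sign_sum_le d (T : measurableType d) (A B : set T) n :
  measurable A -> measurable B ->
  measurable [set t : n.-tuple T |
    \sum_(i < n) (\1_A (tnth t i) - \1_B (tnth t i)) <= 0 :> R].
Proof.
move=> mA mB; have mS : measurable_fun setT
    (fun t : n.-tuple T => \sum_(i < n) (\1_A (tnth t i) - \1_B (tnth t i)) : R).
  apply: measurable_sum => i; apply: measurable_funB.
    by apply: (measurableT_comp _ (measurable_tnth i)); exact: measurable_indic.
  by apply: (measurableT_comp _ (measurable_tnth i)); exact: measurable_indic.
have := mS measurableT _ (measurable_itv `]-oo, 0]).
by rewrite setTI; congr measurable; apply/seteqP; split => t /=; rewrite in_itv.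
Qed.

(** Chernoff's method with the exponent equal to the mean [mu = a - b] of one
    term, which is optimal for the sub-Gaussian bound. *)
Lemma chernoff_sign_sum d (T : measurableType d) (P : probability T R)
    (A B : set T) (a b : R) n : measurable A -> measurable B ->
  A `&` B = set0 -> P A = a%:E -> P B = b%:E -> b <= a ->
  (measure_power P n
     [set t | (\sum_(i < n) (\1_A (tnth t i) - \1_B (tnth t i)) <= 0 :> R)%R]
   <= (expR (- (n%:R * (a - b) ^+ 2 / 2)))%:E)%E.
Proof.
move=> mA mB AB0 PA PB ba.
pose mu := a - b; have mu0 : 0 <= mu by rewrite subr_ge0.
pose xi (x : T) : R := \1_A x - \1_B x.
pose f x := expR (- (mu * xi x)).
pose C := ~` (A `|` B); have mC : measurable C.
  by apply: measurableC; exact: measurableU.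
have PAB : P (A `|` B) = (a + b)%:E 
  by rewrite EFinD -PA -PB; exact: measureU.
have PC : P C = (1 - (a + b))%:E by rewrite probability_setC ?PAB//; exact: measurableU.
have mxi : measurable_fun setT xi by apply: measurable_funB; exact: measurable_indic.
have mf : measurable_fun setT f.
  by apply: measurableT_comp => //; apply: measurableT_comp => //; exact: measurable_funM.
pose c := a * expR (- mu) + b * expR mu + (1 - (a + b)).
have fE x : f x = expR (- mu) * \1_A x + (expR mu * \1_B x + \1_C x).
  rewrite /f /xi !indicE; have [Ax|Ax] := boolP (x \in A).
    have /negbTE Bx : x \notin B.
      apply/negP => /set_mem Bx; suff : set0 x by [].
      by rewrite -AB0; split => //; exact/set_mem.
    have /negbTE -> : x \notin C.
      by apply/negP => /set_mem; apply; left; exact/set_mem.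
    by rewrite Bx subr0 !mulr1 !mulr0 !addr0.
  have [Bx|Bx] := boolP (x \in B).
    have /negbTE -> : x \notin C.
      by apply/negP => /set_mem; apply; right; exact/set_mem.
    by rewrite sub0r mulrN opprK !mulr1 !mulr0 addr0 add0r.
  have -> : x \in C.
    by apply/mem_set => -[]/mem_set; apply/negP.
  by rewrite subrr mulr0 oppr0 expR0 !mulr0 !add0r.
have fc : (\int[P]_x (f x)%:E = c%:E)%E.
  have mI (D : set T) : measurable D -> measurable_fun setT (fun x : T => (\1_D x : R)%:E).
    by move=> mD; apply/measurable_EFinP; exact: measurable_indic.
  have mZ r (D : set T) : measurable D ->
      measurable_fun setT (fun x : T => r%:E * (\1_D x : R)%:E)%E.
    by move=> mD; apply: emeasurable_funM => //; exact: mI.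
  transitivity (\int[P]_x ((expR (- mu))%:E * (\1_A x)%:E
      + ((expR mu)%:E * (\1_B x)%:E + (\1_C x)%:E)))%E.
    by apply: eq_integral => x _; rewrite fE.
  rewrite ge0_integralD//; last 3 first.
  - exact: mZ.
  - by move=> x _; rewrite -EFinM -EFinD lee_fin addr_ge0 ?mulr_ge0 ?expR_ge0.
  - by apply: emeasurable_funD; [exact: mZ|exact: mI].
  rewrite ge0_integralD//; [|exact: mZ|exact: mI].
  rewrite !ge0_integralZl_EFin ?expR_ge0//; [|exact: mI..].
  rewrite !integral_indic// !setIT.
  transitivity ((expR (- mu))%:E * P A + ((expR mu)%:E * P B + P C))%E; first by [].
  by rewrite PA PB PC -!EFinM -!EFinD /c addrA mulrC (mulrC b).
(* The value [0], taken with probability [1 - (a + b)], is harmless because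
   [expR mu + expR (- mu) >= 2]. *)
have c_le : c <= expR (- (mu ^+ 2 / 2)).
  have ab1 : a + b <= 1 by rewrite -lee_fin -PAB probability_le1//; exact: measurableU.
  have /= e1 := expR_ge1Dx mu; have /= e2 := expR_ge1Dx (- mu).
  have h : 0 <= (1 - (a + b)) * (expR mu + expR (- mu) - 2).
    by rewrite mulr_ge0//; lra.
  have := sign_mgf_le mu0; rewrite /c.
  move: h; set e := expR mu; set e' := expR (- mu); set g := expR (- (_ / _)).
  rewrite /mu => h1 h2; nra.
have c0 : 0 <= c.
  by rewrite -lee_fin -fc integral_ge0// => x _; rewrite lee_fin expR_ge0.
set E := [set t | _].
have mE : measurable E by exact: measurable_sign_sum_le.
rewrite -(setIT E) -integral_indic//.
apply: (@le_trans _ _ (\int[measure_power P n]_t (\prod_(i < n) f (tnth t i))%:E)%E).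
  apply: ge0_le_lower_integral => t _; rewrite lee_fin// indicE.
  have [/set_mem Et|_] := boolP (t \in E); last first.
    by apply: prodr_ge0 => i _; exact: expR_ge0.
  rewrite -expR_sum -expR0 ler_expR sumrN oppr_ge0 -mulr_sumr.
  exact: mulr_ge0_le0.
rewrite (integral_measure_power_prod _ mf _ fc); last by move=> x; exact: expR_ge0.
rewrite lee_fin -mulrA -mulrN expRM_natl.
by rewrite lerXn2r ?nnegrE ?expR_ge0.
Qed.

End chernoff.

(** * Clipping *)

Section sections.
Context d1 d2 (T1 : measurableType d1) (T2 : measurableType d2) (R : realType).
Local Open Scope ereal_scope.

Lemma measurable_measure_section (m2 : {sigma_finite_measure set T2 -> \bar R})
    (A : T1 -> set T2) : measurable [set z : T1 * T2 | A z.1 z.2] ->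
  measurable_fun setT (fun x => m2 (A x)).
Proof.
move=> /(measurable_fun_xsection m2); congr measurable_fun.
by apply/funext => x /=; rewrite xsectionE.
Qed.

Lemma measurable_section (A : T1 -> set T2) x :
  measurable [set z : T1 * T2 | A z.1 z.2] -> measurable (A x).
Proof. by move=> /(measurable_xsection x); rewrite xsectionE. Qed.

(** Both sides are product measures, and these agree. *)
Lemma tonelli_section (m1 : {sigma_finite_measure set T1 -> \bar R})
    (m2 : {sigma_finite_measure set T2 -> \bar R}) (A : T1 -> set T2) :
  measurable [set z : T1 * T2 | A z.1 z.2] ->
  \int[m1]_x m2 (A x) = \int[m2]_y m1 [set x | A x y].
Proof.
move=> mA; transitivity ((m1 \x m2) [set z : T1 * T2 | A z.1 z.2]).
  by apply: eq_integral => x _ /=; rewrite xsectionE.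
transitivity ((m1 \x^ m2) [set z : T1 * T2 | A z.1 z.2]).
  by apply: product_measure_unique => //= *; rewrite product_measure2E.
by apply: eq_integral => y _ /=; rewrite ysectionE.
Qed.

End sections.

Lemma integral_scale_indic d (T : measurableType d) (R : realType)
    (mu : {measure set T -> \bar R}) (D : set T) (r : R) :
  measurable D -> 0 <= r ->
  (\int[mu]_x (r * \1_D x)%:E = r%:E * mu D)%E.
Proof.
move=> mD r0; under eq_integral do rewrite EFinM.
rewrite ge0_integralZl_EFin//; last by apply/measurable_EFinP; exact: measurable_indic.
by rewrite integral_indic// setIT.
Qed.

Section clipping.
Context (R : realType) (d : nat) (alpha : R) (m : nat).
Local Notation E := 'rV[R]_d.
Local Notation Leb := (@lebesgue_rV R d).
Implicit Types (G Gamma : set E) (x y z : E).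
Local Open Scope ereal_scope.

Lemma measurable_near_pair (r : R) :
  measurable [set z : E * E | (enorm (z.2 - z.1) <= r)%R].
Proof. exact: measurable_enorm_le. Qed.

Lemma measurable_clip G : measurable G -> measurable (clip alpha m G).
Proof.
move=> mG; apply: measurableI => //.
rewrite -[X in measurable X]setTI; apply: emeasurable_fun_infty_c => //.
apply: (measurable_measure_section lebesgue_rV
  (A := fun x => G `&` eball x (ln m%:R)^-1)).
apply: measurableI; last exact: measurable_near_pair.
by rewrite -[X in measurable X]setTI; exact: measurable_snd.
Qed.

Lemma measurable_clipped G : measurable G -> measurable (clipped alpha m G).
Proof. by move=> mG; apply: measurableD => //; exact: measurable_clip. Qed.

(** Around each point of [Gamma] a fixed fraction of a ball of half the clipping
    radius lies in [Gamma].  Averaging over [Gamma] the measure of the clipped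
    part of such balls therefore controls the clipped part of [Gamma].  Each of
    these measures is small: a half-size ball meeting the clipped part at [z] is
    contained in the clipping ball of [z]. *)
Lemma clip_measure_le (c0 r : R) G Gamma : (ln m%:R)^-1%R = r -> (0 < c0)%R ->
  (0 < r)%R -> measurable G -> measurable Gamma -> Leb Gamma < +oo ->
  (forall x, Gamma x -> (c0 * (r / 2) ^+ d)%:E <= Leb (eball x (r / 2) `&` Gamma)) ->
  Leb (Gamma `&` clip alpha m G) <=
    (2 ^+ d / c0 * fine (Leb Gamma) / m%:R `^ alpha)%:E.
Proof.
move=> rE c00 r0 mG mGamma Goo thick.
set K := Gamma `&` clip alpha m G.
have mK : measurable K by apply: measurableI => //; exact: measurable_clip.
pose A x : set E := [set y | K x /\ (enorm (y - x) <= r / 2)%R /\ Gamma y].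
have mA : measurable [set z : E * E | A z.1 z.2].
  apply: measurableI.
    by rewrite -[X in measurable X]setTI; exact: measurable_fst.
  apply: measurableI; first exact: measurable_near_pair.
  by rewrite -[X in measurable X]setTI; exact: measurable_snd.
pose k := (c0 * (r / 2) ^+ d)%R.
have k0 : (0 < k)%R by rewrite mulr_gt0// exprn_gt0// divr_gt0.
pose e := (r ^+ d / m%:R `^ alpha)%R.
have e0 : (0 <= e)%R by rewrite divr_ge0 ?exprn_ge0 ?powR_ge0// ltW.
have -> : (2 ^+ d / c0 * fine (Leb Gamma) / m%:R `^ alpha)%:E =
    (k^-1)%:E * (e%:E * Leb Gamma).
  rewrite -[X in _ = _ * (_ * X)]fineK ?ge0_fin_numE// -!EFinM; congr EFin.
  rewrite /k /e expr_div_n; move: (_ `^ _)^-1%R => q; field.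
  by rewrite (gt_eqF c00) !expf_neq0 ?gt_eqF.
rewrite lee_pdivlMl// -(integral_scale_indic Leb mK (ltW k0)).
apply: (@le_trans _ _ (\int[Leb]_x Leb (A x))).
  apply: ge0_le_lower_integral => x _; first by rewrite lee_fin mulr_ge0// ltW.
  rewrite indicE; have [/set_mem Kx|_] := boolP (x \in K); last by rewrite mulr0.
rewrite mulr1 (_ : A x = eball x (r / 2) `&` Gamma); first exact: thick Kx.1.
  by apply/seteqP; split => y /=; [case | move=> xy; split].
rewrite (tonelli_section Leb Leb mA) -(integral_scale_indic Leb mGamma e0).
apply: ge0_le_lower_integral => y _ //.
have [Gy|nGy] := pselect (Gamma y); last first.
  have -> : [set x | A x y] = set0; last by rewrite measure0 lee_fin mulr_ge0.
  by apply/seteqP; split => // x [_ []].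
rewrite indicE mem_set// mulr1.
have [->|/set0P[z [[_ [Gz Lz]] [zy _]]]] := eqVneq [set x | A x y] set0.
  by rewrite measure0 lee_fin.
rewrite rE in Lz; apply: le_trans Lz; apply: le_measure; rewrite ?inE.
- have := measurable_ysection y mA; rewrite ysectionE; exact.
- by apply: measurableI => //; exact: measurable_eball.
move=> x [[_ [Gx _]] [yx _]]; split=> //=.
have := enorm_triangle y x z; rewrite (enormB x y) => h.
by apply: (le_trans h); lra.
Qed.

(** As [x] has not been clipped, its ball contains more of [G] than the clipping
    threshold, and none of that lies in [Gamma]. *)
Lemma far_point_excess (r : R) G Gamma x : (ln m%:R)^-1%R = r ->
  measurable G -> measurable Gamma ->
  clipped alpha m G x -> (forall y, Gamma y -> (r < enorm (x - y))%R) ->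
  (r ^+ d / m%:R `^ alpha)%:E <= Leb (G `&` ~` Gamma).
Proof.
move=> rE mG mGamma [Gx nclip] far.
have {}nclip : ~ Leb (G `&` eball x r) <= (r ^+ d / m%:R `^ alpha)%:E.
  by move=> h; apply: nclip; split => //; rewrite rE.
move/negP : nclip; rewrite -ltNge => /ltW/le_trans; apply.
apply: le_measure; rewrite ?inE.
- by apply: measurableI => //; exact: measurable_eball.
- by apply: measurableI => //; exact: measurableC.
move=> y [Gy xy]; split=> // /far; apply/negP.
by rewrite -leNgt enormB.
Qed.

(** The ball around [y] misses [Gt], so the part of it in [Gamma] does too. *)
Lemma uncovered_point_deficit (k r : R) (Gt Gamma : set E) y :
  measurable Gt -> measurable Gamma ->
  k%:E <= Leb (eball y r `&` Gamma) ->
  (forall x, Gt x -> (r < enorm (y - x))%R) ->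
  k%:E <= Leb (Gamma `\` Gt).
Proof.
move=> mG mGamma /le_trans kG far; apply: kG.
apply: le_measure; rewrite ?inE.
- by apply: measurableI => //; exact: measurable_eball.
- exact: measurableD.
move=> x [yx Gx]; split=> // /far; apply/negP.
by rewrite -leNgt enormB.
Qed.

End clipping.

(** * Densities and labels *)

Section density.
Context d (T : measurableType d) (R : realType).
Variables (mu nu : {measure set T -> \bar R}) (p : T -> R).
Local Open Scope ereal_scope.
Import HBNNSimple.
Hypotheses (mp : measurable_fun setT p) (p0 : forall x, (0 <= p x)%R).
Hypothesis nuE : forall A, measurable A -> nu A = \int[mu]_(x in A) (p x)%:E.

Let integral_nnsfun_density (h : {nnsfun T >-> R}) :
  \int[nu]_x (h x)%:E = \int[mu]_x (h x * p x)%:E.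
Proof.
rewrite integralT_nnsfun sintegralE.
have -> : \int[mu]_x (h x * p x)%:E =
    \int[mu]_x \sum_(y \in range h) (y * \1_(h @^-1` [set y]) x * p x)%:E.
  apply: eq_integral => x _.
  by rewrite [in LHS]fimfunE fsumEFin// mulr_fsuml.
rewrite ge0_integral_fsum//; last 2 first.
- move=> y; apply/measurable_EFinP; apply: measurable_funM => //.
  by apply: measurable_funM => //; exact: measurable_indic.
- move=> y x _; rewrite lee_fin mulr_ge0// -lee_fin EFinM.
  exact: nnfun_muleindic_ge0.
apply: eq_fsbigr => y /set_mem[x _ <-].
rewrite nuE// [in LHS]integral_mkcond.
under [RHS]eq_integral do rewrite -mulrA EFinM.
rewrite ge0_integralZl_EFin//; last 2 first.
- by move=> z _; rewrite lee_fin mulr_ge0.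
- by apply/measurable_EFinP; apply: measurable_funM => //; exact: measurable_indic.
congr (_ * _); apply: eq_integral => z _.
by rewrite patchE indicE; case: ifP; rewrite ?mul1r ?mul0r.
Qed.

(** Change of measure from a law to its density, by monotone approximation with
    simple functions. *)
Lemma ge0_integral_density A (g : T -> R) : measurable A ->
  measurable_fun setT g -> (forall x, (0 <= g x)%R) ->
  \int[nu]_(x in A) (g x)%:E = \int[mu]_(x in A) (g x * p x)%:E.
Proof.
move=> mA mg g0.
pose gA x := (g x * \1_A x)%R.
have mgA : measurable_fun setT gA.
  by apply: measurable_funM => //; exact: measurable_indic.
have gA0 x : (0 <= gA x)%R by rewrite mulr_ge0.
have patch (m : {measure set T -> \bar R}) (f : T -> R) :
    \int[m]_(x in A) (f x)%:E = \int[m]_x (f x * \1_A x)%:E.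
  rewrite integral_mkcond; apply: eq_integral => x _.
  by rewrite patchE indicE; case: ifP; rewrite ?mulr1 ?mulr0.
rewrite !patch.
transitivity (\int[mu]_x (gA x * p x)%:E); last first.
  by apply: eq_integral => x _; rewrite /gA mulrAC.
have mgE : measurable_fun setT (EFin \o gA) by exact/measurable_EFinP.
pose h := nnsfun_approx measurableT mgE.
have hg x : (h n x)%:E @[n --> \oo] --> (gA x)%:E.
  by apply: cvg_nnsfun_approx => // y _; rewrite lee_fin.
have ndh x n k : (n <= k)%N -> (h n x <= h k x)%R.
  by move=> nk; exact/lefP/nd_nnsfun_approx.
have limE (m : {measure set T -> \bar R}) (f : T -> R) :
    measurable_fun setT f -> (forall x, 0 <= f x)%R ->
    \int[m]_x (gA x * f x)%:E = limn (fun n => \int[m]_x (h n x * f x)%:E).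
  move=> mf f0; rewrite -monotone_convergence//.
  - apply: eq_integral => x _; apply/esym/cvg_lim => //.
    rewrite EFinM; under eq_fun do rewrite EFinM.
    exact: cvgeZr.
  - by move=> n; apply/measurable_EFinP; exact: measurable_funM.
  - by move=> n x _; rewrite lee_fin mulr_ge0.
  - by move=> x _ n k nk; rewrite lee_fin ler_wpM2r// ndh.
rewrite limE//; under [in RHS]eq_fun do rewrite -integral_nnsfun_density.
transitivity (\int[nu]_x (gA x * cst 1 x)%:E).
  by apply: eq_integral => x _; rewrite /= mulr1.
rewrite limE//; congr (limn _); apply/funext => n.
by apply: eq_integral => x _; rewrite /= mulr1.
Qed.

End density.

Lemma integral_mul_indic d (T : measurableType d) (R : realType)
    (mu : {measure set T -> \bar R}) (A : set T) (f : T -> R) :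
  (\int[mu]_(x in A) (f x)%:E = \int[mu]_x (f x * \1_A x)%:E)%E.
Proof.
rewrite integral_mkcond; apply: eq_integral => x _.
by rewrite patchE indicE; case: ifP; rewrite ?mulr1 ?mulr0.
Qed.

(** On the common part of [N] and [C] the integrands on both sides add up to [f];
    elsewhere the left-hand one is at most [L]. *)
Lemma integral_diff_transfer d (T : measurableType d) (R : realType)
    (mu : {measure set T -> \bar R}) (N C : set T) (f g : T -> R) (L : R) :
  0 <= L -> measurable N -> measurable C ->
  measurable_fun setT f -> measurable_fun setT g ->
  (forall x, 0 <= f x <= L) -> (forall x, 0 <= g x <= L) ->
  (forall x, C x -> g x <= f x) ->
  (\int[mu]_(x in N) (g x)%:E + \int[mu]_(x in C) (f x - g x)%:E <=
   \int[mu]_(x in N) (f x)%:E + (L%:E * mu (C `\` N) + L%:E * mu (N `\` C)))%E.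
Proof.
move=> L0 mN mC mf mg f0L g0L gf.
have [f0 fL] : (forall x, 0 <= f x) /\ (forall x, f x <= L).
  by split => x; have /andP[] := f0L x.
have [g0 gL] : (forall x, 0 <= g x) /\ (forall x, g x <= L).
  by split => x; have /andP[] := g0L x.
have mM (h : T -> R) (A : set T) : measurable A -> measurable_fun setT h ->
    measurable_fun setT (fun x => (h x * \1_A x)%:E).
  by move=> mA mh; apply/measurable_EFinP; exact: measurable_funM.
have mfg : measurable_fun setT (fun x => f x - g x) by exact: measurable_funB.
have gfC x : 0 <= (f x - g x) * \1_C x.
  rewrite indicE; have [/set_mem/gf|_] := boolP (x \in C); last by rewrite mulr0.
  by rewrite mulr1 subr_ge0.
have mD1 : measurable (C `\` N) by exact: measurableD.
have mD2 : measurable (N `\` C) by exact: measurableD.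
have mL (A : set T) : measurable A -> measurable_fun setT (fun x => (L * \1_A x)%:E).
  by move=> mA; exact: (mM (cst L)).
rewrite -!(integral_scale_indic mu _ L0)// !(integral_mul_indic _ N) (integral_mul_indic _ C).
rewrite -!ge0_integralD//; try (by [exact: mM|exact: mL|
  by apply: emeasurable_funD; exact: mL|
  by move=> x _; rewrite -?EFinD lee_fin ?gfC ?addr_ge0 ?mulr_ge0]).
apply: ge0_le_lower_integral => x _.
  by rewrite -EFinD lee_fin addr_ge0 ?gfC ?mulr_ge0.
rewrite -!EFinD lee_fin.
have := gfC x; have := gL x; have := f0 x; have := g0 x; have := fL x.
rewrite !indicE !in_setD.
by case: (x \in N); case: (x \in C); rewrite /= ?mulr1 ?mulr0; lra.
Qed.

Section labels.
Context (R : realType) (d : nat) (P : probability ('rV[R]_d * bool)%type R).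
Variables (p eta : 'rV[R]_d -> R).
Local Notation E := 'rV[R]_d.
Local Notation Leb := (@lebesgue_rV R d).
Hypotheses (mp : measurable_fun setT p) (p0 : forall x, 0 <= p x).
Hypothesis pP : is_density P p.
Hypotheses (meta : measurable_fun setT eta) (eta01 : forall x, 0 <= eta x <= 1).
Hypothesis etaP : is_regression P eta.
Implicit Types (A N C : set E).

Let eta0 x : 0 <= eta x. Proof. by case/andP: (eta01 x). Qed.
Let eta1 x : 0 <= 1 - eta x. Proof. by rewrite subr_ge0; case/andP: (eta01 x). Qed.

Lemma integral_density_le1 A : measurable A -> (\int[Leb]_(x in A) (p x)%:E <= 1)%E.
Proof. by move=> mA; rewrite -pP// probability_le1. Qed.

Lemma label1_mass A : measurable A ->
  P (A `*` [set true]) = (\int[Leb]_(x in A) (eta x * p x)%:E)%E.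
Proof.
by move=> mA; rewrite etaP// (@ge0_integral_density _ _ _ Leb (marginal_X P) p).
Qed.

Lemma label0_mass A : measurable A ->
  P (A `*` [set false]) = (\int[Leb]_(x in A) ((1 - eta x) * p x)%:E)%E.
Proof.
move=> mA; have mA1 b : measurable (A `*` [set b] : set (E * bool)).
  exact: measurableX.
have sumP : (P (A `*` [set true]) + P (A `*` [set false]) =
    \int[Leb]_(x in A) (p x)%:E)%E.
  rewrite -pP// /marginal_X /distribution /pushforward.
  rewrite -[LHS](@measureU _ _ _ P)//; last first.
    by apply/seteqP; split => // -[x b] /= [[_ ->] [_]].
  congr (P _); apply/seteqP; split => [[x b] /= [[]|[]]//|[x [|]] /= Ax].
    by left.
  by right.
have sumI : (\int[Leb]_(x in A) (eta x * p x)%:E +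
    \int[Leb]_(x in A) ((1 - eta x) * p x)%:E = \int[Leb]_(x in A) (p x)%:E)%E.
  rewrite -ge0_integralD//.
  - by apply: eq_integral => x _; rewrite -EFinD -mulrDl addrC subrK mul1r.
  - by move=> x _; rewrite lee_fin mulr_ge0.
  - by apply/measurable_EFinP/measurable_funTS; exact: measurable_funM.
  - by move=> x _; rewrite lee_fin mulr_ge0.
  - apply/measurable_EFinP/measurable_funTS; apply: measurable_funM => //.
    exact: measurable_funB.
have fin1 : P (A `*` [set true]) \is a fin_num by exact: fin_num_measure.
move: sumI; rewrite -sumP -label1_mass// => /(congr1 (fun x => x - P (A `*` [set true]))%E).
by rewrite addeAC subee// add0e addeAC subee// add0e.
Qed.

Lemma margin_integrandE x :
  `|2 * eta x - 1| * p x = `|eta x * p x - (1 - eta x) * p x|.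
Proof.
by rewrite -mulrBl normrM (ger0_norm (p0 x)); congr (`|_| * _); ring.
Qed.

Lemma margin_integrand_le x : 0 <= `|2 * eta x - 1| * p x <= p x.
Proof.
rewrite mulr_ge0//= ler_piMl// ler_norml.
by have := eta01 x; lra.
Qed.

Lemma measurable_margin_integrand :
  measurable_fun setT (fun x => `|2 * eta x - 1| * p x).
Proof.
apply: measurable_funM => //; apply: measurableT_comp => //.
by apply: measurable_funB => //; exact: measurable_funM.
Qed.

Lemma margin_integral_le1 A : measurable A ->
  (\int[Leb]_(x in A) (`|2 * eta x - 1| * p x)%:E <= 1)%E.
Proof.
move=> mA; apply: le_trans (integral_density_le1 mA).
by apply: ge0_le_lower_integral => x _; have /andP[] := margin_integrand_le x.
Qed.

Lemma EFin_margin C : measurable C ->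
  ((margin p eta C)%:E = \int[Leb]_(x in C) (`|2 * eta x - 1| * p x)%:E)%E.
Proof.
move=> mC; rewrite fineK// ge0_fin_numE.
  by rewrite (le_lt_trans (margin_integral_le1 mC))// ltry.
by apply: integral_ge0 => x _; have /andP[] := margin_integrand_le x.
Qed.

Lemma margin_ge0 C : 0 <= margin p eta C.
Proof.
apply: fine_ge0; apply: integral_ge0 => x _.
by have /andP[] := margin_integrand_le x.
Qed.

Lemma voteE n (l : n.-tuple (E * bool)) N : vote l N =
  \sum_(i < n) (\1_(N `*` [set true]) (tnth l i) - \1_(N `*` [set false]) (tnth l i)).
Proof.
have in1 (b c : bool) : (b \in [set c]) = (b == c).
  by apply/idP/eqP => [/set_mem//|->]; exact/mem_set.
apply: eq_bigr => i _; case: (tnth l i) => x b; rewrite !indicE/= !in_setX/= !in1.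
by case: b; case: (x \in N) => /=; ring.
Qed.

End labels.

Section voting.
Context (R : realType) (d : nat) (P : probability ('rV[R]_d * bool)%type R).
Variables (p eta : 'rV[R]_d -> R) (L : R).
Local Notation E := 'rV[R]_d.
Local Notation Leb := (@lebesgue_rV R d).
Hypotheses (mp : measurable_fun setT p) (p0L : forall x, 0 <= p x <= L).
Hypothesis pP : is_density P p.
Hypotheses (meta : measurable_fun setT eta) (eta01 : forall x, 0 <= eta x <= 1).
Hypothesis etaP : is_regression P eta.
Implicit Types (A N C : set E).

Let p0 x : 0 <= p x. Proof. by case/andP: (p0L x). Qed.

Let L0 : 0 <= L.
Proof. by have /andP[a b] := p0L 0; exact: le_trans a b. Qed.

Definition wrong_vote n N (b : bool) : set (n.-tuple (E * bool)) :=
  [set l | (0 < vote l N) != b].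

Lemma measurable_vote n N : measurable N ->
  measurable_fun setT (fun l : n.-tuple (E * bool) => vote l N).
Proof.
move=> mN; under eq_fun do rewrite voteE.
apply: measurable_sum => i; apply: measurable_funB.
  apply: (measurableT_comp _ (measurable_tnth i)); apply: measurable_indic.
  exact: measurableX.
apply: (measurableT_comp _ (measurable_tnth i)); apply: measurable_indic.
exact: measurableX.
Qed.

Lemma measurable_wrong_vote n N b : measurable N ->
  measurable (@wrong_vote n N b).
Proof.
move=> mN; have m1 : measurable [set l : n.-tuple (E * bool) | 0 < vote l N].
  have := measurable_vote (n := n) mN measurableT (measurable_itv `]0, +oo[).
  rewrite setTI; congr measurable; apply/seteqP.
  by split => l /=; rewrite in_itv/= andbT.
case: b; rewrite /wrong_vote.
  rewrite (_ : [set l | _] = ~` [set l : n.-tuple (E * bool) | 0 < vote l N]).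
    exact: measurableC.
  by apply/seteqP; split => l /=; case: (0 < _) => // -[].
rewrite (_ : [set l | _] = [set l : n.-tuple (E * bool) | 0 < vote l N]) //.
by apply/seteqP; split => l /=; case: (0 < _).
Qed.

(** The votes of the two labels have expected masses that differ by at least
    [delta - e] in favour of [b].  Either [e] is below [(1 - theta) * delta],
    the difference is at least [theta * delta] and a wrong vote is an
    exponentially rare deviation, or [delta] is at most [e / (1 - theta)] and
    the trivial bound on the probability suffices. *)
Lemma wrong_vote_le n N (b : bool) (theta e delta : R) :
  measurable N -> 0 < theta < 1 -> 0 <= delta -> 0 <= e ->
  fine (P (N `*` [set ~~ b])) + delta <= fine (P (N `*` [set b])) + e ->
  (delta%:E * measure_power P n (@wrong_vote n N b) <=
   (delta * expR (- (n%:R * (theta * delta) ^+ 2 / 2)) + e / (1 - theta))%:E)%E.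
Proof.
move=> mN /andP[th0 th1] delta0 e0 gap.
have th1' : 0 < 1 - theta by rewrite subr_gt0.
have mb c : measurable (N `*` [set c] : set (E * bool)) by exact: measurableX.
have mW := @measurable_wrong_vote n N b mN.
have W1 : (measure_power P n (@wrong_vote n N b) <= 1)%E.
  by rewrite -(measure_power_setT P n); apply: le_measure; rewrite ?inE.
have [big|small] := leP ((1 - theta) * delta) e.
  apply: (@le_trans _ _ (delta%:E * 1)%E); first by rewrite lee_wpmul2l ?lee_fin.
  rewrite mule1 lee_fin ler_wpDl ?mulr_ge0 ?expR_ge0//.
  by rewrite ler_pdivlMr// mulrC.
rewrite EFinD.
apply: (@le_trans _ _
  (delta * expR (- (n%:R * (theta * delta) ^+ 2 / 2)))%:E); last first.
  by rewrite -EFinD lee_fin lerDl divr_ge0// ltW.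
rewrite EFinM lee_wpmul2l ?lee_fin//.
set a := fine (P (N `*` [set b])) in gap *; set c := fine (P (N `*` [set ~~ b])) in gap *.
have ac : theta * delta <= a - c by nra.
have td0 : 0 <= theta * delta by rewrite mulr_ge0// ltW.
have disj : (N `*` [set b]) `&` (N `*` [set ~~ b]) = set0.
  by apply/seteqP; split => // -[x b'] /= [[_ ->] [_]]; case: (b).
have fP c' : P (N `*` [set c']) = (fine (P (N `*` [set c'])))%:E.
  by rewrite fineK// fin_num_measure.
have := @chernoff_sign_sum _ _ _ P (N `*` [set b]) (N `*` [set ~~ b]) a c n
  (mb _) (mb _) disj (fP _) (fP _).
rewrite -subr_ge0 => /(_ (le_trans td0 ac)) cher.
apply: (@le_trans _ _ (expR (- (n%:R * (a - c) ^+ 2 / 2)))%:E); last first.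
  by rewrite lee_fin ler_expR lerN2 ler_pM2r// ler_wpM2l// ler_sqr ?nnegrE// (le_trans td0).
apply: le_trans cher; apply: le_measure; rewrite ?inE//.
  exact: measurable_sign_sum_le.
move=> l; rewrite /wrong_vote /= voteE.
case: b {gap a c ac disj mW W1}.
  by rewrite eqb_id -leNgt.
rewrite eqbF_neg negbK /= => /ltW; rewrite -oppr_le0 -sumrN.
by congr (_ <= _); apply: eq_bigr => i _; rewrite opprB.
Qed.

End voting.

(** * Risk given the unlabeled sample *)

Lemma measurable_sum_seq d (T : measurableType d) (R : realType)
    (I : eqType) (s : seq I) (f : I -> T -> R) :
  (forall i, i \in s -> measurable_fun setT (f i)) ->
  measurable_fun setT (fun x => \sum_(i <- s) f i x).
Proof.
elim: s => [|i s IHs] mf.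
  by under eq_fun do rewrite big_nil; exact: measurable_cst.
under eq_fun do rewrite big_cons; apply: measurable_funD.
  by apply: mf; exact: mem_head.
by apply: IHs => j js; apply: mf; rewrite in_cons js orbT.
Qed.

Lemma ge0_integral_big_seq d (T : measurableType d) (R : realType)
    (mu : {measure set T -> \bar R}) (I : eqType) (s : seq I) (f : I -> T -> R) :
  (forall i, i \in s -> measurable_fun setT (f i)) ->
  (forall i x, i \in s -> 0 <= f i x) ->
  (\int[mu]_x (\sum_(i <- s) f i x)%:E = \sum_(i <- s) \int[mu]_x (f i x)%:E)%E.
Proof.
elim: s => [|i s IHs] mf f0.
  rewrite big_nil; under eq_integral do rewrite big_nil.
  by rewrite integral0.
rewrite big_cons -IHs => [|j js|j x js]; last 2 first.
- by apply: mf; rewrite in_cons js orbT.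
- by apply: f0; rewrite in_cons js orbT.
under eq_integral do rewrite big_cons EFinD.
rewrite ge0_integralD//.
- by move=> x _; rewrite lee_fin f0 ?mem_head.
- by apply/measurable_EFinP/mf; exact: mem_head.
- move=> x _; rewrite lee_fin big_seq; apply: sumr_ge0 => j js.
  by apply: f0; rewrite in_cons js orbT.
- apply/measurable_EFinP; apply: measurable_sum_seq => j js.
  by apply: mf; rewrite in_cons js orbT.
Qed.

Lemma sum_integral_disjoint_le d (T : measurableType d) (R : realType)
    (mu : {measure set T -> \bar R}) (I : eqType) (s : seq I) (F : I -> set T)
    (M : set T) (w : T -> R) :
  uniq s -> (forall i, i \in s -> measurable (F i)) -> measurable M ->
  (forall i, i \in s -> F i `<=` M) ->
  (forall i j x, i \in s -> j \in s -> F i x -> F j x -> i = j) ->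
  measurable_fun setT w -> (forall x, 0 <= w x) ->
  (\sum_(i <- s) \int[mu]_(x in F i) (w x)%:E <= \int[mu]_(x in M) (w x)%:E)%E.
Proof.
move=> us mF mM FM disj mw w0; rewrite integral_mul_indic.
rewrite (_ : (\sum_(i <- s) _ = \sum_(i <- s) \int[mu]_x (w x * \1_(F i) x)%:E)%E); last first.
  by apply: eq_bigr => i _; rewrite integral_mul_indic.
rewrite -ge0_integral_big_seq//; last 2 first.
- move=> i si; apply: measurable_funM => //; apply: measurable_indic.
  exact: mF.
- by move=> i x _; rewrite mulr_ge0.
apply: ge0_le_lower_integral => x _; rewrite lee_fin.
  by apply: sumr_ge0 => i _; rewrite mulr_ge0.
have [[i si Fx]|nF] := pselect (exists2 i, i \in s & F i x).
  rewrite (bigD1_seq i)//= big1_seq ?addr0.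
    by rewrite !indicE (mem_set Fx) (mem_set (FM _ si _ Fx)).
  move=> j /andP[ji sj]; rewrite indicE memNset ?mulr0// => Fj.
  by move: ji; rewrite (disj j i x)// eqxx.
rewrite big1_seq ?mulr_ge0// => j /andP[_ sj].
by rewrite indicE memNset ?mulr0// => Fj; apply: nF; exists j.
Qed.

Lemma sum_measure_disjoint_le d (T : measurableType d) (R : realType)
    (mu : {measure set T -> \bar R}) (I : eqType) (s : seq I) (F : I -> set T)
    (M : set T) :
  uniq s -> (forall i, i \in s -> measurable (F i)) -> measurable M ->
  (forall i, i \in s -> F i `<=` M) ->
  (forall i j x, i \in s -> j \in s -> F i x -> F j x -> i = j) ->
  (\sum_(i <- s) mu (F i) <= mu M)%E.
Proof.
move=> us mF mM FM disj.
rewrite (_ : (\sum_(i <- s) mu (F i) =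
    \sum_(i <- s) \int[mu]_(x in F i) (cst 1 x)%:E)%E); last first.
  rewrite big_seq [RHS]big_seq; apply: eq_bigr => i si.
  by rewrite -[LHS]mul1e -integral_cst//; exact: mF.
rewrite (le_trans (sum_integral_disjoint_le mu us mF mM FM disj _ _))//.
by rewrite -[leRHS]mul1e -integral_cst.
Qed.

Section conditional_risk.
Context (R : realType) (d : nat) (P : probability ('rV[R]_d * bool)%type R).
Variables (p eta : 'rV[R]_d -> R) (L : R).
Local Notation E := 'rV[R]_d.
Local Notation Leb := (@lebesgue_rV R d).
Hypotheses (mp : measurable_fun setT p) (p0L : forall x, 0 <= p x <= L).
Hypothesis pP : is_density P p.
Hypotheses (meta : measurable_fun setT eta) (eta01 : forall x, 0 <= eta x <= 1).
Hypothesis etaP : is_regression P eta.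
Implicit Types (A N C T : set E).

Let p0 x : 0 <= p x. Proof. by case/andP: (p0L x). Qed.

Let L0 : 0 <= L.
Proof. by have /andP[a b] := p0L 0; exact: le_trans a b. Qed.

(** The vote is counted on [N] instead of the component [C]; the labels that are
    gained or lost amount to at most [L] times the measure of the symmetric
    difference. *)
Lemma vote_error_le n N C (b : bool) (theta : R) :
  measurable N -> measurable C -> 0 < theta < 1 ->
  (Leb (C `\` N) < +oo)%E -> (Leb (N `\` C) < +oo)%E ->
  (forall x, C x -> (2^-1 <= eta x) = b) ->
  ((margin p eta C)%:E * measure_power P n (@wrong_vote R d n N b) <=
   (margin p eta C * expR (- (n%:R * (theta * margin p eta C) ^+ 2 / 2)) +
    L * (fine (Leb (C `\` N)) + fine (Leb (N `\` C))) / (1 - theta))%:E)%E.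
Proof.
move=> mN mC th CN NC etab.
apply: wrong_vote_le => //.
- exact: (margin_ge0 p0 eta01).
- by rewrite mulr_ge0// addr_ge0// fine_ge0.
pose f c x := (if c then eta x else 1 - eta x) * p x.
have mf c : measurable_fun setT (f c).
  apply: measurable_funM => //; case: c => //.
  exact: measurable_funB.
have fL c x : 0 <= f c x <= L.
  have /andP[e0 e1] := eta01 x; have /andP[_ pL] := p0L x.
  rewrite /f; case: c.
    by rewrite mulr_ge0//= (le_trans _ pL)// ler_piMl.
  by rewrite mulr_ge0 ?subr_ge0//= (le_trans _ pL)// ler_piMl// gerBl.
have massE c : P (N `*` [set c]) = (\int[Leb]_(x in N) (f c x)%:E)%E.
  case: c; first exact: (label1_mass mp p0 pP meta eta01 etaP mN).
  exact: (label0_mass mp p0 pP meta eta01 etaP mN).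
have ff x : C x -> f (~~ b) x <= f b x.
  move=> /etab; rewrite /f; case: b {f mf fL massE etab} => /= h;
    apply: ler_wpM2r => //; first lra.
  by move/negbT : h; rewrite -ltNge; lra.
have marginE : (\int[Leb]_(x in C) (f b x - f (~~ b) x)%:E =
    (margin p eta C)%:E)%E.
  rewrite (EFin_margin p0 pP eta01 mC); apply: eq_integral => x /set_mem Cx.
  congr EFin; rewrite (@margin_integrandE R d p eta p0).
  have := ff x Cx; rewrite /f; case: (b) => /= h.
    by rewrite ger0_norm// subr_ge0.
  by rewrite ler0_norm ?opprB// subr_le0.
have h : (P (N `*` [set ~~ b]) + (margin p eta C)%:E <=
    P (N `*` [set b]) + (L%:E * Leb (C `\` N) + L%:E * Leb (N `\` C)))%E.
  rewrite !massE -marginE.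
  exact: (integral_diff_transfer Leb L0 mN mC (mf b) (mf (~~ b)) (fL b) (fL (~~ b)) ff).
have fP c : P (N `*` [set c]) = (fine (P (N `*` [set c])))%:E.
  by rewrite fineK// fin_num_measure//; exact: measurableX.
have fCN : Leb (C `\` N) = (fine (Leb (C `\` N)))%:E.
  by rewrite fineK// ge0_fin_numE.
have fNC : Leb (N `\` C) = (fine (Leb (N `\` C)))%:E.
  by rewrite fineK// ge0_fin_numE.
rewrite (fP b) (fP (~~ b)) fCN fNC -!EFinM -!EFinD lee_fin in h.
by rewrite mulrDr.
Qed.

(** Outside of [Gt] the error is bounded by the mass missed there; inside, all
    points of one component [T] are misclassified together, namely when the vote
    over [N T] is wrong. *)
Lemma conditional_risk_le n (S : seq (set E)) (N : set E -> set E)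
    (b : set E -> bool) (Gamma Gt : set E) (theta : R)
    (g : n.-tuple (E * bool) -> E -> R) :
  uniq S -> (forall T, T \in S -> measurable T) ->
  (forall T, T \in S -> T `<=` Gamma) ->
  (forall x, Gamma x -> exists2 T, T \in S & T x) ->
  (forall T T' x, T \in S -> T' \in S -> T x -> T' x -> T = T') ->
  measurable Gamma -> measurable Gt -> (Leb Gamma < +oo)%E -> (Leb Gt < +oo)%E ->
  (forall T, T \in S -> measurable (N T)) ->
  (forall T, T \in S -> N T `<=` Gt) ->
  (forall T, T \in S -> N T `&` Gamma = T `&` Gt) ->
  (forall T T' x, T \in S -> T' \in S -> N T x -> N T' x -> T = T') ->
  (forall T x, T \in S -> T x -> (2^-1 <= eta x) = b T) ->
  (forall l T x, T \in S -> T x -> Gt x -> g l x = (0 < vote l (N T))%R%:R) ->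
  0 < theta < 1 ->
  (\int[measure_power P n]_l \int[Leb]_(x in Gamma)
     (`|2 * eta x - 1| * (g l x != bayes eta x)%:R * p x)%:E <=
   (\sum_(T <- S) margin p eta T * expR (- (n%:R * (theta * margin p eta T) ^+ 2 / 2))
    + L * (2 * fine (Leb (Gamma `\` Gt)) + fine (Leb (Gt `\` Gamma)))
      / (1 - theta))%:E)%E.
Proof.
move=> uS mS SG GS disjS mG mGt Goo Gtoo mN NGt NG disjN etab gE th.
pose w x := `|2 * eta x - 1| * p x.
have w0 x : 0 <= w x by have /andP[] := margin_integrand_le p0 eta01 x.
have wL x : w x <= L.
  have /andP[_ /le_trans] := margin_integrand_le p0 eta01 x; apply.
  by case/andP: (p0L x).
have mw : measurable_fun setT w := measurable_margin_integrand mp meta.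
have mD : measurable (Gamma `\` Gt) by exact: measurableD.
pose W T : set (n.-tuple (E * bool)) := wrong_vote (N T) (b T).
have mW T : T \in S -> measurable (W T).
  by move=> ST; apply: measurable_wrong_vote; exact: mN.
pose K := fine (Leb (Gamma `\` Gt)).
have KE : Leb (Gamma `\` Gt) = K%:E.
  rewrite fineK// ge0_fin_numE// (le_lt_trans _ Goo)// le_measure ?inE//.
have inner l : (\int[Leb]_(x in Gamma)
     (`|2 * eta x - 1| * (g l x != bayes eta x)%:R * p x)%:E <=
   (L * K + \sum_(T <- S) margin p eta T * \1_(W T) l)%:E)%E.
  pose B T x : R := w x * \1_T x * \1_(W T) l.
  apply: (@le_trans _ _ (\int[Leb]_x
      ((w x * \1_(Gamma `\` Gt) x)%:E + (\sum_(T <- S) B T x)%:E)))%E.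
    rewrite [leLHS]integral_mul_indic; apply: ge0_le_lower_integral => x _.
      by rewrite lee_fin !mulr_ge0.
    rewrite -EFinD lee_fin.
    have B0 T : 0 <= B T x by rewrite !mulr_ge0.
    have sB0 : 0 <= \sum_(T <- S) B T x by apply: sumr_ge0 => T _; exact: B0.
    have [Gx|nGx] := pselect (Gamma x); last first.
      by rewrite [\1_Gamma x]indicE memNset// mulr0 addr_ge0// mulr_ge0.
    rewrite [\1_Gamma x]indicE mem_set// mulr1.
    have [Gtx|nGtx] := pselect (Gt x); last first.
      rewrite ler_wpDr// indicE mem_set// mulr1.
      by case: (_ != _); rewrite /w ?mulr1 ?mulr0 ?mul0r ?mulr_ge0.
    rewrite ler_wpDl ?mulr_ge0//.
    have [T ST Tx] := GS x Gx.
    rewrite (bigD1_seq T)//= ler_wpDr//; first by apply: sumr_ge0 => T' _; exact: B0.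
    rewrite /B (gE l T x)// /bayes (etab T x)// indicE mem_set// mulr1 indicE.
    rewrite [in leRHS](_ : (l \in W T) = ((0 < vote l (N T))%R != b T)); last first.
      by apply/idP/idP => [/set_mem//|h]; exact/mem_set.
    rewrite /w -mulrA [X in _ * X]mulrC mulrA ler_wpM2l//; first exact: w0.
    by rewrite eqr_nat; move: (0 < vote l (N T)) (b T) => [] [].
  rewrite ge0_integralD//; last 4 first.
  - by move=> x _; rewrite lee_fin mulr_ge0.
  - apply/measurable_EFinP; apply: measurable_funM => //; exact: measurable_indic.
  - by move=> x _; rewrite lee_fin; apply: sumr_ge0 => T _; rewrite !mulr_ge0.
  - apply/measurable_EFinP; apply: measurable_sum_seq => T ST.
    apply: measurable_funM => //; apply: measurable_funM => //.
    by apply: measurable_indic; exact: mS.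
  rewrite EFinD leeD//.
    rewrite -integral_mul_indic EFinM -KE -integral_cst//.
    by apply: ge0_le_lower_integral => x _; rewrite lee_fin.
  rewrite ge0_integral_big_seq; last 2 first.
  - move=> T ST; apply: measurable_funM => //; apply: measurable_funM => //.
    by apply: measurable_indic; exact: mS.
  - by move=> T x _; rewrite !mulr_ge0.
  rewrite -sumEFin big_seq [leRHS]big_seq; apply: lee_sum => T ST.
  rewrite /B indicE; have [_|_] := boolP (l \in W T).
    rewrite mulr1 (EFin_margin p0 pP eta01 (mS _ ST)) [leRHS]integral_mul_indic.
    by under eq_integral do rewrite mulr1.
  by under eq_integral do rewrite mulr0; rewrite integral0 mulr0.
apply: (@le_trans _ _ (\int[measure_power P n]_l
   (L * K + \sum_(T <- S) margin p eta T * \1_(W T) l)%:E)%E).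
  apply: ge0_le_lower_integral => l _ //; apply: integral_ge0 => x _.
  by rewrite lee_fin !mulr_ge0.
under eq_integral do rewrite EFinD.
rewrite ge0_integralD//; last 3 first.
- by move=> l _; rewrite lee_fin mulr_ge0// fine_ge0.
- move=> l _; rewrite lee_fin; apply: sumr_ge0 => T _.
  by rewrite mulr_ge0// (margin_ge0 p0 eta01).
- apply/measurable_EFinP; apply: measurable_sum_seq => T ST.
  apply: measurable_funM => //; apply: measurable_indic; exact: mW.
have -> : (\int[measure_power P n]_l (L * K)%:E = (L * K)%:E)%E.
  rewrite integral_cst//; transitivity ((L * K)%:E * measure_power P n setT)%E => //.
  by rewrite measure_power_setT mule1.
rewrite ge0_integral_big_seq; last 2 first.
- move=> T ST; apply: measurable_funM => //; apply: measurable_indic; exact: mW.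
- by move=> T l _; rewrite mulr_ge0// (margin_ge0 p0 eta01).
have NT T : T \in S -> N T `\` T = N T `\` Gamma.
  move=> ST; apply/seteqP; split => x [Nx nx]; split=> // xx; apply: nx.
    have : (N T `&` Gamma) x by [].
    by rewrite NG// => -[].
  exact: SG ST _ xx.
have TN T : T \in S -> T `\` N T = T `\` Gt.
  move=> ST; apply/seteqP; split => x [Tx nx]; split=> // xx; apply: nx.
    have : (T `&` Gt) x by [].
    by rewrite -NG// => -[].
  exact: NGt ST _ xx.
pose K' := fine (Leb (Gt `\` Gamma)).
have mD' : measurable (Gt `\` Gamma) by exact: measurableD.
have K'E : Leb (Gt `\` Gamma) = K'%:E.
  rewrite fineK// ge0_fin_numE// (le_lt_trans _ Gtoo)// le_measure ?inE//.
have mTN T : T \in S -> measurable (T `\` Gt).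
  by move=> ST; apply: measurableD => //; exact: mS.
have mNT T : T \in S -> measurable (N T `\` Gamma).
  by move=> ST; apply: measurableD => //; exact: mN.
have finTN T : T \in S -> Leb (T `\` Gt) = (fine (Leb (T `\` Gt)))%:E.
  move=> ST; rewrite fineK// ge0_fin_numE// (@le_lt_trans _ _ K%:E) ?ltry// -KE.
  rewrite le_measure ?inE//; first exact: mTN.
  by apply: setSD; exact: SG.
have finNT T : T \in S -> Leb (N T `\` Gamma) = (fine (Leb (N T `\` Gamma)))%:E.
  move=> ST; rewrite fineK// ge0_fin_numE// (@le_lt_trans _ _ K'%:E) ?ltry// -K'E.
  rewrite le_measure ?inE//; first exact: mNT.
  by apply: setSD; exact: NGt.
have sumTN : \sum_(T <- S) fine (Leb (T `\` Gt)) <= K.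
  rewrite -lee_fin -KE -sumEFin big_seq.
  rewrite (eq_bigr (fun T => Leb (T `\` Gt))) => [|T ST]; last by rewrite -finTN.
  rewrite -big_seq; apply: sum_measure_disjoint_le => //.
  - by move=> T ST; apply: setSD; exact: SG.
  - by move=> T T' x ST ST' [Tx _] [T'x _]; exact: disjS Tx T'x.
have sumNT : \sum_(T <- S) fine (Leb (N T `\` Gamma)) <= K'.
  rewrite -lee_fin -K'E -sumEFin big_seq.
  rewrite (eq_bigr (fun T => Leb (N T `\` Gamma))) => [|T ST]; last by rewrite -finNT.
  rewrite -big_seq; apply: sum_measure_disjoint_le => //.
  - by move=> T ST; apply: setSD; exact: NGt.
  - by move=> T T' x ST ST' [Tx _] [T'x _]; exact: disjN Tx T'x.
have th1 : 0 < 1 - theta by case/andP: th => *; rewrite subr_gt0.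
apply: (@le_trans _ _ ((L * K)%:E + \sum_(T <- S) (margin p eta T *
    expR (- (n%:R * (theta * margin p eta T) ^+ 2 / 2)) +
    L * (fine (Leb (T `\` Gt)) + fine (Leb (N T `\` Gamma))) / (1 - theta))%:E)%E).
  rewrite leeD2l// big_seq [leRHS]big_seq; apply: lee_sum => T ST.
  rewrite integral_scale_indic ?(margin_ge0 p0 eta01)//; last exact: mW.
  rewrite -NT// -TN//; apply: vote_error_le => //.
  - exact: mN.
  - exact: mS.
  - by rewrite TN// finTN// ltry.
  - by rewrite NT// finNT// ltry.
  - by move=> x; exact: etab.
rewrite sumEFin -EFinD lee_fin big_split/= -mulr_suml -mulr_sumr big_split/=.
rewrite addrCA lerD2l -/K -/K'.
have K0 : 0 <= K by exact: fine_ge0.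
have h : L * K <= L * K / (1 - theta).
  by rewrite ler_pdivlMr// ler_piMr ?mulr_ge0// gerBl; case/andP: th => /ltW.
apply: (le_trans (lerD h (lexx _))).
rewrite -mulrDl -mulrDr ler_wpM2r ?invr_ge0 ?(ltW th1)// ler_wpM2l//; lra.
Qed.

End conditional_risk.

(** * Components of the level set *)

Section level_components.
Context (R : realType) (d : nat) (Gamma : set 'rV[R]_d) (c0 r0 s0 : R).
Local Notation E := 'rV[R]_d.
Local Notation Leb := (@lebesgue_rV R d).
Hypotheses (c0_gt0 : 0 < c0) (r0_gt0 : 0 < r0) (s0_gt0 : 0 < s0).
Hypothesis mGamma : measurable Gamma.
Hypothesis rGamma : forall T, components Gamma T -> r_connected c0 r0 T.
Hypothesis sGamma : separated_by s0 (components Gamma).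
Implicit Types T : set E.

Lemma component_eq T T' x : components Gamma T -> components Gamma T' ->
  T x -> T' x -> T = T'.
Proof.
move=> CT CT' Tx T'x; apply: contrapT => TT'.
have := separated_components sGamma CT CT' Tx T'x TT'.
by rewrite subrr enorm0; apply/negP; rewrite -ltNge.
Qed.

Lemma measurable_component T : components Gamma T -> measurable T.
Proof.
move=> CT; apply: (separated_measurable s0_gt0 mGamma (component_sub CT)).
move=> x y Tx Gy nTy; have [T' CT' T'y] := component_cover Gy.
apply: (separated_components sGamma CT CT' Tx T'y) => TT'.
by apply: nTy; rewrite TT'.
Qed.

Lemma component_thick T x (r : R) : components Gamma T -> T x -> 0 <= r <= r0 ->
  ((c0 * r ^+ d)%:E <= Leb (eball x r `&` T))%E.
Proof.
move=> CT Tx rr; have [f [_ f0 _ _]] := rGamma CT Tx Tx.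
by move=> /(_ 0 r); rewrite f0 lexx ler01 => /(_ isT rr).
Qed.

Lemma level_set_thick x (r : R) : Gamma x -> 0 <= r <= r0 ->
  ((c0 * r ^+ d)%:E <= Leb (eball x r `&` Gamma))%E.
Proof.
move=> Gx rr; have [T CT Tx] := component_cover Gx.
rewrite (le_trans (component_thick CT Tx rr))// le_measure ?inE//.
- apply: measurableI; [exact: measurable_eball | exact: measurable_component].
- apply: measurableI => //; exact: measurable_eball.
- exact: setIS (component_sub CT).
Qed.

(** Each component has measure at least [c0 * r0 ^+ d], and they are disjoint. *)
Lemma finite_components : (Leb Gamma < +oo)%E -> finite_set (components Gamma).
Proof.
move=> Goo; apply: contrapT => inf.
pose e := c0 * r0 ^+ d; have e0 : 0 < e by rewrite mulr_gt0// exprn_gt0.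
have [k kP] : exists k : nat, fine (Leb Gamma) < k%:R * e.
  exists (Num.trunc (fine (Leb Gamma) / e)).+1.
  by rewrite -ltr_pdivrMr// truncnS_gt.
have [B' B'C kB] := infinite_set_fset k inf.
set B := finmap.enum_fset B' in kB.
have BC T : T \in B -> components Gamma T by move=> TB; exact: B'C.
have uB : uniq B by exact: finmap.fset_uniq.
have LebT T : components Gamma T -> (e%:E <= Leb T)%E.
  move=> CT; have [x Gx xT] := CT.
  have Tx : T x.
    by rewrite -xT; exact: path_component_center.
  rewrite (le_trans (component_thick CT Tx (r := r0) _)) ?lexx ?(ltW r0_gt0)//.
  rewrite le_measure ?inE//.
  - apply: measurableI; [exact: measurable_eball | exact: measurable_component].
  - exact: measurable_component.
have : (\sum_(T <- B) Leb T <= Leb Gamma)%E.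
  apply: (sum_measure_disjoint_le Leb (F := id)) => //.
  - by move=> T TB; apply: measurable_component; exact: BC.
  - by move=> T TB; apply: component_sub; exact: BC.
  - by move=> T T' x TB T'B; apply: component_eq; exact: BC.
apply/negP; rewrite -ltNge (@lt_le_trans _ _ (k%:R * e)%:E)//.
  by rewrite -(@fineK _ (Leb Gamma)) ?lte_fin// ge0_fin_numE.
apply: (@le_trans _ _ (\sum_(T <- B) e%:E)%E).
  rewrite sumEFin lee_fin big_const_seq count_predT iter_addr_0 -[leRHS]mulr_natl.
  by rewrite ler_wpM2r ?(ltW e0)// ler_nat.
rewrite big_seq [leRHS]big_seq; apply: lee_sum => T TB.
by apply: LebT; exact: BC.
Qed.

End level_components.

Section risk_given_unlabeled.
Context (R : realType) (d : nat) (P : probability ('rV[R]_d * bool)%type R).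
Variables (X : set 'rV[R]_d) (p eta : 'rV[R]_d -> R).
Variables (L lam alpha c0 r0 s0 : R).
Local Notation E := 'rV[R]_d.
Local Notation Leb := (@lebesgue_rV R d).
Local Notation Gamma := (level_set X p lam).
Hypotheses (mX : measurable X) (Xoo : (Leb X < +oo)%E).
Hypotheses (mp : measurable_fun setT p) (p0L : forall x, 0 <= p x <= L).
Hypothesis pP : is_density P p.
Hypotheses (meta : measurable_fun setT eta) (eta01 : forall x, 0 <= eta x <= 1).
Hypothesis etaP : is_regression P eta.
Hypotheses (c0_gt0 : 0 < c0) (r0_gt0 : 0 < r0) (s0_gt0 : 0 < s0).
Hypothesis clusterGamma : cluster_assumption eta Gamma.
Hypothesis rGamma : forall T, components Gamma T -> r_connected c0 r0 T.
Hypothesis sGamma : separated_by s0 (components Gamma).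
Implicit Types T : set E.

Let p0 x : 0 <= p x. Proof. by case/andP: (p0L x). Qed.

Let L0 : 0 <= L.
Proof. by have /andP[a b] := p0L 0; exact: le_trans a b. Qed.

Lemma measurable_level_set : measurable Gamma.
Proof.
apply: measurableI => //.
have := mp measurableT (measurable_itv `[lam, +oo[).
by rewrite setTI; congr measurable; apply/seteqP; split => x /=; rewrite in_itv/= andbT.
Qed.

Lemma level_set_finite : (Leb Gamma < +oo)%E.
Proof.
rewrite (le_lt_trans _ Xoo)// le_measure ?inE//; first exact: measurable_level_set.
by move=> x [].
Qed.

Lemma inner_risk_le1 (g : E -> R) :
  (\int[Leb]_(x in Gamma)
     (`|2 * eta x - 1| * (g x != bayes eta x)%:R * p x)%:E <= 1)%E.
Proof.
apply: le_trans (margin_integral_le1 p0 pP eta01 measurable_level_set).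
apply: ge0_le_lower_integral => x _; first by rewrite lee_fin !mulr_ge0.
by rewrite lee_fin ler_wpM2r// ler_piMr// lern1 leq_b1.
Qed.

(** The right-hand side is affine in the two errors of the estimate with
    deterministic coefficients, so that it can be integrated over the unlabeled
    sample.  The terms with [kappa] and with [m%:R `^ alpha / r ^+ d] pay for
    the samples from which the clusters are not recovered. *)
Lemma risk_given_unlabeled n m (G : forall m, m.-tuple E -> set E) (u : m.-tuple E)
    (r theta : R) (S : seq (set E)) (D := fine (Leb Gamma)) (kappa := 2 ^+ d / (c0 * r ^+ d)) :
  (ln m%:R)^-1 = r -> 0 < r -> 4 * r < s0 -> r <= r0 ->
  0 < theta < 1 -> uniq S -> components Gamma = [set` S] ->
  measurable (G m u) -> G m u `<=` X ->
  (\int[measure_power P n]_l \int[Leb]_(x in Gamma)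
     (`|2 * eta x - 1| * (classifier alpha G l u x != bayes eta x)%:R * p x)%:E <=
   (\sum_(T <- S) margin p eta T * expR (- (n%:R * (theta * margin p eta T) ^+ 2 / 2)))%:E
    + (((2 * L + kappa) / (1 - theta))%:E * Leb (G m u `+` Gamma)
    + (((L + m%:R `^ alpha / r ^+ d) / (1 - theta))%:E * Leb (G m u `&` ~` Gamma)
    + ((2 * L + kappa) * (2 ^+ d / c0 * D / m%:R `^ alpha) / (1 - theta))%:E)))%E.
Proof.
move=> rE r_gt0 rs rr0 th uS SE mG GX.
have mGamma := measurable_level_set; have Goo := level_set_finite.
have th1 : 0 < 1 - theta by case/andP: th => *; rewrite subr_gt0.
set Gt := clipped alpha m (G m u).
have mGt : measurable Gt by exact: measurable_clipped.
have GtG : Gt `<=` G m u by move=> x [].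
have mfin A : measurable A -> A `<=` X -> Leb A = (fine (Leb A))%:E.
  move=> mA AX; rewrite fineK// ge0_fin_numE// (le_lt_trans _ Xoo)//.
  by rewrite le_measure ?inE.
have GammaX : Gamma `<=` X by move=> x [].
have mMiss : measurable (Gamma `\` Gt) by exact: measurableD.
have mExc : measurable (G m u `&` ~` Gamma).
  by apply: measurableI => //; exact: measurableC.
have mSym : measurable (G m u `+` Gamma).
  by apply: measurableU; exact: measurableD.
pose a := fine (Leb (Gamma `\` Gt)); pose b := fine (Leb (G m u `&` ~` Gamma)).
pose a' := fine (Leb (G m u `+` Gamma)).
have aE : Leb (Gamma `\` Gt) = a%:E by apply: mfin => // x [/GammaX].
have bE : Leb (G m u `&` ~` Gamma) = b%:E by apply: mfin => // x [/GX].
have a'E : Leb (G m u `+` Gamma) = a'%:E by apply: mfin => // x [[/GX]|[/GammaX]].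
have a0 : 0 <= a by exact: fine_ge0. 
have b0 : 0 <= b by exact: fine_ge0.
have a'0 : 0 <= a' by exact: fine_ge0.
have aa' : a <= a' + 2 ^+ d / c0 * D / m%:R `^ alpha.
  have mclip : measurable (clip alpha m (G m u)) by exact: measurable_clip.
  rewrite -lee_fin EFinD -aE -a'E.
  apply: (@le_trans _ _ (Leb (G m u `+` Gamma) + Leb (Gamma `&` clip alpha m (G m u)))%E).
    have mK : measurable (Gamma `&` clip alpha m (G m u)) by exact: measurableI.
    have h := measureU2 Leb mSym mK; apply: le_trans h.
    rewrite le_measure ?inE//; first exact: measurableU.
    move=> x [Gx nGtx]; have [Gux|nGux] := pselect (G m u x); last by left; right.
    by right; split=> //; apply: contrapT => nc; apply: nGtx; split.
  rewrite leeD2l//; apply: clip_measure_le rE _ _ _ _ _ _ => // x Gx.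
  apply: (level_set_thick s0_gt0 mGamma rGamma sGamma Gx).
  by apply/andP; split; lra.
have kappa0 : 0 <= kappa.
  by rewrite divr_ge0 ?exprn_ge0// mulr_ge0 ?exprn_ge0// ltW.
pose q := m%:R `^ alpha / r ^+ d.
have q0 : 0 <= q by rewrite divr_ge0 ?powR_ge0// exprn_ge0// ltW.
pose Sig := \sum_(T <- S) margin p eta T * expR (- (n%:R * (theta * margin p eta T) ^+ 2 / 2)).
have Sig0 : 0 <= Sig.
  by apply: sumr_ge0 => T _; rewrite mulr_ge0 ?expR_ge0// (margin_ge0 p0 eta01).
apply: (@le_trans _ _
  (Sig + (L * (2 * a + b) + b * q + a * kappa) / (1 - theta))%:E); last first.
  rewrite a'E bE -!EFinM -!EFinD lee_fin lerD2l.
  set Z := (2 ^+ d / c0 * D / _) in aa' *.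
  rewrite [leRHS](_ : _ = ((2 * L + kappa) * (a' + Z) + (L + q) * b) / (1 - theta)).
    apply: ler_wpM2r; first by rewrite invr_ge0 ltW.
    rewrite [leLHS](_ : _ = (2 * L + kappa) * a + (L + q) * b).
      by rewrite lerD2r ler_wpM2l// addr_ge0// mulr_ge0.
    by ring.
  by rewrite /q; ring.
(* When the clusters are not recovered, one of the two errors exceeds its
   threshold, and the risk is at most [1]. *)
have bad : 1 <= b * q \/ 1 <= a * kappa ->
  (\int[measure_power P n]_l \int[Leb]_(x in Gamma)
     (`|2 * eta x - 1| * (classifier alpha G l u x != bayes eta x)%:R * p x)%:E <=
   (Sig + (L * (2 * a + b) + b * q + a * kappa) / (1 - theta))%:E)%E.
  move=> bad; apply: (@le_trans _ _ (\int[measure_power P n]_l 1)%E).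
    apply: ge0_le_lower_integral => l _; last exact: inner_risk_le1.
    by apply: integral_ge0 => x _; rewrite lee_fin !mulr_ge0.
  rewrite integral_cst//; rewrite [X in (_ * X)%E](measure_power_setT P n) mule1.
  rewrite lee_fin ler_wpDl// ler_pdivlMr// mul1r.
  have La : 0 <= L * (2 * a + b) by rewrite mulr_ge0 ?addr_ge0 ?mulr_ge0.
  have bq : 0 <= b * q by rewrite mulr_ge0.
  have ak : 0 <= a * kappa by rewrite mulr_ge0.
  by case/andP: th => *; case: bad => ?; lra.
have rd0 : 0 < r ^+ d by rewrite exprn_gt0.
have ma0 : 0 < m%:R `^ alpha.
  rewrite powR_gt0//; move: r_gt0; rewrite -rE; case: (m) => [|k _]; last exact: ltr0Sn.
  by rewrite ln0// invr0 ltxx.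
have [far|nfar] := pselect (exists2 x, Gt x & forall y, Gamma y -> r < enorm (x - y)).
  apply: bad; left; have [x Gx xfar] := far.
  have := far_point_excess rE mG mGamma Gx xfar; rewrite bE lee_fin.
  by rewrite /q mulrA ler_pdivrMr// ler_pdivlMr// mul1r.
have [unc|nunc] := pselect (exists2 y, Gamma y & forall x, Gt x -> r / 2 < enorm (y - x)).
  apply: bad; right; have [y Gy yfar] := unc.
  have rr : 0 <= r / 2 <= r0 by apply/andP; split; lra.
  have thick := level_set_thick s0_gt0 mGamma rGamma sGamma Gy rr.
  have := uncovered_point_deficit mGt mGamma thick yfar; rewrite aE lee_fin.
  rewrite expr_div_n mulrA ler_pdivrMr ?exprn_gt0// => h.
  by rewrite /kappa mulrA ler_pdivlMr ?mulr_gt0// mul1r.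
have near1 x : Gt x -> exists2 y, Gamma y & enorm (x - y) <= r.
  move=> Gx; apply: contrapT => h; apply: nfar; exists x => // y Gy.
  by rewrite ltNge; apply/negP => xy; apply: h; exists y.
have near2 y : Gamma y -> exists2 x, Gt x & enorm (y - x) <= r / 2.
  move=> Gy; apply: contrapT => h; apply: nunc; exists y => // x Gx.
  by rewrite ltNge; apply/negP => xy; apply: h; exists x.
have path T : components Gamma T -> forall x y, T x -> T y -> exists f, path_in T x y f.
  by move=> CT x y Tx Ty; have [f] := rGamma CT Tx Ty; exists f.
have CS T : T \in S -> components Gamma T by rewrite SE.
pose bT T := `[< exists2 x, T x & 2^-1 <= eta x >].
apply: (le_trans (@conditional_risk_le _ _ P p eta L mp p0L pP meta eta01 etaP n S
  (trace_near Gt r) bT Gamma Gt theta (fun l => classifier alpha G l u)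
  uS _ _ _ _ mGamma mGt Goo _ _ _ _ _ _ _ th)).
- by move=> T /CS; exact: (measurable_component s0_gt0 mGamma sGamma).
- by move=> T /CS; exact: component_sub.
- by move=> x Gx; have [T CT Tx] := component_cover Gx; exists T => //; move: CT; rewrite SE.
- by move=> T T' x /CS CT /CS CT'; exact: (component_eq s0_gt0 sGamma CT CT').
- rewrite (le_lt_trans _ Xoo)// le_measure ?inE//.
  by move=> x /GtG/GX.
- by move=> T /CS CT; exact: (measurable_trace_near r_gt0 rs sGamma near1).
- by move=> T _ x [].
- by move=> T /CS CT; exact: (trace_near_Gamma Gt r_gt0 rs sGamma CT).
- by move=> T T' x /CS CT /CS CT'; exact: (trace_near_inj r_gt0 rs sGamma CT CT').
- move=> T x /CS CT Tx.
  have eq_bayes y : T y -> (2^-1 <= eta x) = (2^-1 <= eta y).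
    move=> Ty; have /eqP := clusterGamma.2 T CT x y Tx Ty.
    by rewrite /bayes eqr_nat; move: (_ <= eta x) (_ <= eta y) => [] [].
  by apply/idP/asboolP => [etax|[y /eq_bayes ->]//]; exists x.
- move=> l T x /CS CT Tx Gx; rewrite /classifier.
  apply: (merged_sumE rE r_gt0 rs sGamma path near1 near2
    (fun H => (0 < vote l H)%R%:R) CT).
  by split=> //; exists x => //; rewrite subrr enorm0 ltW.
rewrite lee_fin -/Sig lerD2l; apply: ler_wpM2r; first by rewrite invr_ge0 ltW.
rewrite -/a; apply: (@le_trans _ _ (L * (2 * a + b))); last first.
  have bq0 : 0 <= b * q by exact: mulr_ge0.
  have ak0 : 0 <= a * kappa by exact: mulr_ge0.
  by rewrite -[leRHS]addrA lerDl addr_ge0.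
apply: ler_wpM2l => //; rewrite lerD2l.
have mE : measurable (Gt `\` Gamma) by exact: measurableD.
rewrite -lee_fin -mfin//; last by move=> x [/GtG/GX].
rewrite -bE le_measure ?inE//.
by move=> x [/GtG].
Qed.

End risk_given_unlabeled.

(** * Quantities bounded up to logarithmic factors *)

Section soft_bigO.
Context (R : realType).
Implicit Types (u : nat -> \bar R) (v : nat -> R).

Lemma ln_natr_gt0 m : (1 < m)%N -> 0 < ln m%:R :> R.
Proof. by move=> m1; rewrite ln_gt0// ltr1n. Qed.

(** Since [ln m] is at least [ln 2], a smaller power of it is at most a constant
    times a larger one; this lets finitely many bounds with different powers of
    [ln m] be added. *)
Lemma powR_ln_le (e f : R) m : e <= f -> (1 < m)%N ->
  ln m%:R `^ e <= ln 2 `^ (e - f) * ln m%:R `^ f.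
Proof.
move=> ef m1; have l2 : 0 < ln 2 :> R by exact: (ln_natr_gt0 (m := 2)).
pose q : R := ln m%:R / ln 2.
have q1 : 1 <= q.
  by rewrite ler_pdivlMr// mul1r ler_ln ?posrE ?ltr0n ?ler_nat// ltnW.
have powE g : ln m%:R `^ g = ln 2 `^ g * q `^ g.
  by rewrite -powRM ?(ltW l2) ?(le_trans ler01 q1)// mulrC divfK// gt_eqF.
rewrite !powE mulrA -powRD; last by rewrite (gt_eqF l2) implybT.
by rewrite subrK ler_wpM2l ?powR_ge0// ler_powR.
Qed.

Lemma soft_bigO_le u1 u2 v : (forall m, (1 < m)%N -> (u1 m <= u2 m)%E) ->
  soft_bigO u2 v -> soft_bigO u1 v.
Proof.
move=> u12 [C [b [C0 b0 Cb]]]; exists C, b; split => // m m1.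
exact: le_trans (u12 m m1) (Cb m m1).
Qed.

Lemma soft_bigOD u1 u2 v : (forall m, 0 <= v m) ->
  soft_bigO u1 v -> soft_bigO u2 v -> soft_bigO (fun m => u1 m + u2 m)%E v.
Proof.
move=> v0 [C1 [b1 [C10 b10 H1]]] [C2 [b2 [C20 b20 H2]]].
pose c b := ln 2 `^ (b - (b1 + b2)) : R.
have c0 b : 0 < c b by rewrite powR_gt0//; exact: (ln_natr_gt0 (m := 2)).
exists (C1 * c b1 + C2 * c b2), (b1 + b2); split.
- by rewrite addr_gt0// mulr_gt0.
- exact: addr_gt0.
move=> m m1; apply: (le_trans (leeD (H1 m m1) (H2 m m1))).
rewrite -EFinD lee_fin !mulrDl lerD// ler_wpM2r// -mulrA ler_wpM2l ?(ltW C10) ?(ltW C20)//.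
  by apply: powR_ln_le => //; rewrite lerDl ltW.
by apply: powR_ln_le => //; rewrite lerDr ltW.
Qed.

Lemma soft_bigO_mul_ln u v (k e : R) : 0 <= k -> 0 <= e -> (forall m, 0 <= v m) ->
  soft_bigO u v -> soft_bigO (fun m => (k * ln m%:R `^ e)%:E * u m)%E v.
Proof.
move=> k0 e0 v0 [C [b [C0 b0 H]]]; exists ((k + 1) * C), (e + b); split.
- by rewrite mulr_gt0// ltr_wpDl.
- by rewrite ltr_wpDl.
move=> m m1; apply: (@le_trans _ _ ((k * ln m%:R `^ e)%:E * (C * ln m%:R `^ b * v m)%:E)%E).
  by apply: lee_wpmul2l (H m m1); rewrite lee_fin mulr_ge0// powR_ge0.
rewrite -EFinM lee_fin powRD; last by rewrite (gt_eqF (ln_natr_gt0 m1)) implybT.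
rewrite [leLHS](_ : _ = k * (C * (ln m%:R `^ e * ln m%:R `^ b) * v m)); last by ring.
rewrite [leRHS](_ : _ = (k + 1) * (C * (ln m%:R `^ e * ln m%:R `^ b) * v m)); last by ring.
by rewrite ler_wpM2r ?lerDl// !mulr_ge0 ?powR_ge0// ltW.
Qed.

Lemma soft_bigO_scale u v (k : R) : 0 <= k -> (forall m, 0 <= v m) ->
  soft_bigO u v -> soft_bigO (fun m => k%:E * u m)%E v.
Proof.
move=> k0 v0 /(soft_bigO_mul_ln k0 (lexx 0) v0).
by apply: soft_bigO_le => m _; rewrite powRr0 mulr1.
Qed.

Lemma soft_bigO_refl v : (forall m, 0 <= v m) -> soft_bigO (fun m => (v m)%:E) v.
Proof.
move=> v0; have l2 : 0 < ln 2 :> R by exact: (ln_natr_gt0 (m := 2)).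
exists (ln 2 `^ (0 - 1)), 1; split => //; first exact: powR_gt0.
move=> m m1; rewrite lee_fin ler_peMl//.
by have := powR_ln_le ler01 m1; rewrite powRr0.
Qed.

Lemma soft_bigO_lt (M : nat) (alpha : R) : 0 < alpha ->
  soft_bigO (fun m => ((m < M)%N%:R)%:E) (fun m => m%:R `^ (- alpha)).
Proof.
move=> a0; have v0 m : 0 <= m%:R `^ (- alpha) :> R by exact: powR_ge0.
have := soft_bigO_scale (powR_ge0 M%:R alpha) v0 (soft_bigO_refl v0).
apply: soft_bigO_le => m m1; rewrite -EFinM lee_fin.
case: ltnP => mM; last by rewrite mulr_ge0// powR_ge0.
have m0 : 0 < m%:R :> R by rewrite ltr0n ltnW.
rewrite powRN ler_pdivlMr ?powR_gt0// mul1r.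
by apply: ge0_ler_powR; rewrite ?nnegrE ?ler_nat ?(ltnW mM) ?(ltW a0).
Qed.

End soft_bigO.

(** * The excess risk bound *)

Section excess_risk.
Context (R : realType) (d : nat) (P : probability ('rV[R]_d * bool)%type R).
Variables (X : set 'rV[R]_d) (p eta : 'rV[R]_d -> R).
Variables (L lam alpha c0 r0 s0 : R).
Variable G : forall m, m.-tuple 'rV[R]_d -> set 'rV[R]_d.
Local Notation E := 'rV[R]_d.
Local Notation Leb := (@lebesgue_rV R d).
Local Notation Gamma := (level_set X p lam).
Hypotheses (mX : measurable X) (Xoo : (Leb X < +oo)%E).
Hypotheses (mp : measurable_fun setT p) (p0L : forall x, 0 <= p x <= L).
Hypothesis pP : is_density P p.
Hypotheses (meta : measurable_fun setT eta) (eta01 : forall x, 0 <= eta x <= 1).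
Hypothesis etaP : is_regression P eta.
Hypotheses (alpha_gt0 : 0 < alpha).
Hypotheses (c0_gt0 : 0 < c0) (r0_gt0 : 0 < r0) (s0_gt0 : 0 < s0).
Hypothesis clusterGamma : cluster_assumption eta Gamma.
Hypothesis rGamma : forall T, components Gamma T -> r_connected c0 r0 T.
Hypothesis sGamma : separated_by s0 (components Gamma).
Hypotheses (estG : set_estimator X G) (consG : consistent_from_inside P alpha Gamma G).

Let p0 x : 0 <= p x. Proof. by case/andP: (p0L x). Qed.

Let L0 : 0 <= L.
Proof. by have /andP[a b] := p0L 0; exact: le_trans a b. Qed.

Let mGamma : measurable Gamma.
Proof. exact: measurable_level_set. Qed.

Let v0 m : 0 <= m%:R `^ (- alpha) :> R.
Proof. exact: powR_ge0. Qed.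

Let risk n m := thresholded_risk P p eta Gamma (@classifier R d alpha G n m).

Let exp_sum n theta (S : seq (set E)) : R :=
  \sum_(T <- S) margin p eta T * expR (- (n%:R * (theta * margin p eta T) ^+ 2 / 2)).

Let exp_sum_ge0 n theta S : 0 <= exp_sum n theta S.
Proof.
by apply: sumr_ge0 => T _; rewrite mulr_ge0 ?expR_ge0// (margin_ge0 p0 eta01).
Qed.

Lemma risk_le1 n m : (risk n m <= 1)%E.
Proof.
have one k d' (T : measurableType d') (Q : probability T R) :
    (\int[measure_power Q k]_t 1 = 1)%E.
  by rewrite integral_cst// mul1e; exact: measure_power_setT.
apply: (le_trans (lower_fubini _ _ _)).
  move=> z; apply: integral_ge0 => x _.
  by rewrite lee_fin !mulr_ge0.
rewrite -(one m _ _ (marginal_X P)); apply: ge0_le_lower_integral => u _.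
  apply: integral_ge0 => l _; apply: integral_ge0 => x _.
  by rewrite lee_fin !mulr_ge0.
rewrite -(one n _ _ P); apply: ge0_le_lower_integral => l _.
  by apply: integral_ge0 => x _; rewrite lee_fin !mulr_ge0.
exact: (inner_risk_le1 _ mX mp p0L pP eta01).
Qed.

Let measurable_estimator m (u : m.-tuple E) : measurable (G u).
Proof. exact: (measurable_section u (estG m).1). Qed.

Let measurable_excess m :
  measurable_fun setT (fun u : m.-tuple E => Leb (G u `&` ~` Gamma)).
Proof.
apply: (measurable_measure_section Leb (A := fun u : m.-tuple E => G u `&` ~` Gamma)).
apply: measurableI; first exact: (estG m).1.
rewrite -[X in measurable X]setTI; apply: measurable_snd => //.
exact: measurableC.
Qed.

Let measurable_symdiff m :
  measurable_fun setT (fun u : m.-tuple E => Leb (G u `+` Gamma)).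
Proof.
apply: (measurable_measure_section Leb (A := fun u : m.-tuple E => G u `+` Gamma)).
have mG2 : measurable [set z : m.-tuple E * E | Gamma z.2].
  by rewrite -[X in measurable X]setTI; exact: measurable_snd.
by apply: measurableU; apply: measurableD => //; exact: (estG m).1.
Qed.

(** For such [m] the clipping radius is small compared with [r0] and [s0], and
    the bound for a fixed unlabeled sample can be integrated. *)
Lemma risk_le_large n m (theta : R) (S : seq (set E))
    (kappa := 2 ^+ d / c0 * ln m%:R ^+ d) :
  (1 < m)%N -> 4 * (ln m%:R)^-1 < s0 -> (ln m%:R)^-1 <= r0 ->
  0 < theta < 1 -> uniq S -> components Gamma = [set` S] ->
  (risk n m <= (exp_sum n theta S)%:E + ((1 - theta)^-1)%:E *
   ((2 * L + kappa)%:E * \int[measure_power (marginal_X P) m]_u Leb (G u `+` Gamma)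
   + (L + m%:R `^ alpha * ln m%:R ^+ d)%:E *
       \int[measure_power (marginal_X P) m]_u Leb (G u `&` ~` Gamma)
   + ((2 * L + kappa) * (2 ^+ d / c0 * fine (Leb Gamma)) * m%:R `^ (- alpha))%:E))%E.
Proof.
move=> m1 ms mr th uS SE.
have lm := @ln_natr_gt0 R m m1.
have th1 : 0 < (1 - theta)^-1 by case/andP: th => *; rewrite invr_gt0 subr_gt0.
have kappa0 : 0 <= kappa.
  by rewrite mulr_ge0 ?divr_ge0 ?exprn_ge0// ltW.
pose r : R := (ln m%:R)^-1.
have r_gt0 : 0 < r by rewrite invr_gt0.
have kappaE : kappa = 2 ^+ d / (c0 * r ^+ d).
  by rewrite /kappa /r exprVn invfM invrK mulrA.
pose k1 := (2 * L + kappa) / (1 - theta).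
pose k2 := (L + m%:R `^ alpha * ln m%:R ^+ d) / (1 - theta).
pose k3 := (2 * L + kappa) * (2 ^+ d / c0 * fine (Leb Gamma) / m%:R `^ alpha) / (1 - theta).
have k10 : 0 <= k1 by rewrite mulr_ge0 ?(ltW th1)// addr_ge0// mulr_ge0.
have k20 : 0 <= k2.
  by rewrite mulr_ge0 ?(ltW th1)// addr_ge0// mulr_ge0 ?powR_ge0// exprn_ge0// ltW.
have k30 : 0 <= k3.
  rewrite mulr_ge0 ?(ltW th1)// mulr_ge0//; first by rewrite addr_ge0// mulr_ge0.
  by rewrite !mulr_ge0 ?invr_ge0 ?powR_ge0 ?exprn_ge0 ?fine_ge0 ?(ltW c0_gt0).
apply: (@le_trans _ _ (\int[measure_power (marginal_X P) m]_u
   ((exp_sum n theta S)%:E + (k1%:E * Leb (G u `+` Gamma)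
     + (k2%:E * Leb (G u `&` ~` Gamma) + k3%:E))))%E).
  apply: (le_trans (lower_fubini _ _ _)).
    by move=> z; apply: integral_ge0 => x _; rewrite lee_fin !mulr_ge0.
  apply: ge0_le_lower_integral => u _.
    apply: integral_ge0 => l _; apply: integral_ge0 => x _.
    by rewrite lee_fin !mulr_ge0.
  rewrite /k1 /k2 /k3 kappaE -[ln m%:R ^+ d]invrK -exprVn -/r.
  exact: (risk_given_unlabeled alpha mX Xoo mp p0L pP meta eta01 etaP c0_gt0
    s0_gt0 clusterGamma rGamma sGamma n (G := G) erefl r_gt0 ms mr th uS SE
    (measurable_estimator u) ((estG m).2 u)).
have cstE (c : R) : (\int[measure_power (marginal_X P) m]_u c%:E = c%:E)%E.
  rewrite integral_cst//; transitivity (c%:E * measure_power (marginal_X P) m setT)%E => //.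
  by rewrite measure_power_setT mule1.
set A := (\int[_]_u Leb (G u `+` Gamma))%E.
set B := (\int[_]_u Leb (G u `&` ~` Gamma))%E.
have A0 : (0 <= A)%E by exact: integral_ge0.
have B0 : (0 <= B)%E by exact: integral_ge0.
have mk k (f : m.-tuple E -> \bar R) : measurable_fun setT f ->
    measurable_fun setT (fun u : m.-tuple E => k%:E * f u)%E.
  by move=> mf; exact: emeasurable_funM.
have mkA := mk k1 _ (measurable_symdiff (m := m)).
have mkB := mk k2 _ (measurable_excess (m := m)).
have mkBC : measurable_fun setT (fun u : m.-tuple E =>
    k2%:E * Leb (G u `&` ~` Gamma) + k3%:E)%E.
  exact: emeasurable_funD.
have k1A u : (0 <= k1%:E * Leb (G u `+` Gamma))%E by rewrite mule_ge0// lee_fin.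
have k2B u : (0 <= k2%:E * Leb (G u `&` ~` Gamma))%E by rewrite mule_ge0// lee_fin.
have k23 u : (0 <= k2%:E * Leb (G u `&` ~` Gamma) + k3%:E)%E by rewrite adde_ge0 ?lee_fin.
rewrite ge0_integralD//; last 3 first.
- by move=> u _; rewrite lee_fin.
- by move=> u _; rewrite adde_ge0.
- exact: emeasurable_funD.
rewrite ge0_integralD// ge0_integralD//.
rewrite !cstE !ge0_integralZl_EFin//; last 2 first.
- exact: measurable_excess.
- exact: measurable_symdiff.
rewrite -/A -/B.
have K10 : 0 <= 2 * L + kappa by rewrite addr_ge0// mulr_ge0.
have K20 : 0 <= L + m%:R `^ alpha * ln m%:R ^+ d.
  by rewrite addr_ge0// mulr_ge0 ?powR_ge0// exprn_ge0// ltW.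
have K30 : 0 <= (2 * L + kappa) * (2 ^+ d / c0 * fine (Leb Gamma)) * m%:R `^ (- alpha).
  rewrite mulr_ge0 ?powR_ge0// mulr_ge0// mulr_ge0 ?fine_ge0//.
  by rewrite divr_ge0 ?exprn_ge0// ltW.
have KA : (0 <= (2 * L + kappa)%:E * A)%E by rewrite mule_ge0// lee_fin.
have KB : (0 <= (L + m%:R `^ alpha * ln m%:R ^+ d)%:E * B)%E.
  by rewrite mule_ge0// lee_fin.
have KAB := adde_ge0 KA KB.
rewrite (ge0_muleDr _ KAB) ?lee_fin// (ge0_muleDr _ KA KB) !muleA -!EFinM -addeA.
rewrite (mulrC _ (2 * L + kappa)) (mulrC _ (L + _)) (mulrC _ (_ * _ `^ (- alpha))).
by rewrite -/k1 -/k2 /k3 powRN !mulrA.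
Qed.

(** The finitely many [m] whose clipping radius is not small compared with the
    geometry of [Gamma] only contribute to the constant, since the risk is at
    most [1]. *)
Lemma risk_soft_bound (S : seq (set E)) : uniq S -> components Gamma = [set` S] ->
  exists C b : R, [/\ 0 < C, 0 < b &
    forall n m (theta : R), (1 < m)%N -> 0 < theta < 1 ->
      (risk n m <= (C * ln m%:R `^ b * (m%:R `^ (- alpha) / (1 - theta)))%:E
        + (exp_sum n theta S)%:E)%E].
Proof.
move=> uS SE; have [symO excO] := consG.
pose A m := (\int[measure_power (marginal_X P) m]_u Leb (G u `+` Gamma))%E.
pose B m := (\int[measure_power (marginal_X P) m]_u Leb (G u `&` ~` Gamma))%E.
pose k := 2 ^+ d / c0; pose D := fine (Leb Gamma).
pose v (m : nat) : R := m%:R `^ (- alpha).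
have k0 : 0 <= k by rewrite divr_ge0 ?exprn_ge0// ltW.
have D0 : 0 <= D by exact: fine_ge0.
have A0 m : (0 <= A m)%E by exact: integral_ge0.
have B0 m : (0 <= B m)%E by exact: integral_ge0.
have LL0 : 0 <= 2 * L by rewrite mulr_ge0.
have kD0 : 0 <= k * D by rewrite mulr_ge0.
pose K : R := Num.max (4 / s0) r0^-1.
pose M := (Num.trunc (expR K)).+1.
have large m : (M <= m)%N -> 4 * (ln m%:R)^-1 < s0 /\ (ln m%:R)^-1 <= r0.
  move=> Mm; have Km : K < ln m%:R.
    rewrite -ltr_expR lnK ?posrE.
      by rewrite (lt_le_trans (truncnS_gt _))// ler_nat.
    by rewrite ltr0n (leq_trans _ Mm).
  have [K1 K2] : 4 / s0 < ln m%:R /\ r0^-1 < ln m%:R.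
    by move: Km; rewrite /K gt_max => /andP.
  have lm : 0 < ln m%:R :> R by rewrite (lt_trans _ K2)// invr_gt0.
  split; first by rewrite ltr_pdivrMr// mulrC -ltr_pdivrMr.
  by rewrite -[r0]invrK lef_pV2 ?posrE ?invr_gt0// ltW.
pose Z m := ((2 * L + k * ln m%:R ^+ d) * (k * D) * v m)%R.
pose U m := ((2 * L + k * ln m%:R ^+ d)%:E * A m
  + (L + m%:R `^ alpha * ln m%:R ^+ d)%:E * B m + (Z m)%:E
  + ((m < M)%N%:R)%:E)%E.
have lnd m : (1 < m)%N -> ln m%:R ^+ d = ln m%:R `^ d%:R :> R.
  by move=> m1; rewrite powR_mulrn// ltW// ln_natr_gt0.
have UO : soft_bigO U v.
  apply: soft_bigOD => //; last exact: soft_bigO_lt.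
  apply: soft_bigOD => //; first apply: soft_bigOD => //.
  - apply: (@soft_bigO_le _ _ (fun m => (2 * L)%:E * A m + (k * ln m%:R `^ d%:R)%:E * A m)%E).
      move=> m m1; rewrite lnd// EFinD ge0_muleDl ?lee_fin//.
      by rewrite mulr_ge0// powR_ge0.
    apply: soft_bigOD => //; first exact: soft_bigO_scale.
    exact: soft_bigO_mul_ln.
  (* The excess is compensated by [m%:R `^ alpha]: this is where its faster
     rate is used. *)
  - have B'O : soft_bigO (fun m => (m%:R `^ alpha)%:E * B m)%E v.
      have [C [b [C0 b0 H]]] := excO; exists C, b; split => // m m1.
      apply: (le_trans (lee_wpmul2l _ (H m m1))); first by rewrite lee_fin powR_ge0.
      rewrite -EFinM lee_fin mulrCA -powRD; last first.
        by rewrite pnatr_eq0 -lt0n (ltnW m1) implybT.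
      by rewrite /v (_ : alpha + - (2 * alpha) = - alpha)//; ring.
    apply: (@soft_bigO_le _ _ (fun m => L%:E * ((m%:R `^ alpha)%:E * B m)
        + (1 * ln m%:R `^ d%:R)%:E * ((m%:R `^ alpha)%:E * B m))%E).
      move=> m m1; have ma1 : 1 <= m%:R `^ alpha :> R.
        by rewrite -[leLHS](powRr0 m%:R) ler_powR ?(ltW alpha_gt0)// ler1n ltnW.
      rewrite EFinD ge0_muleDl ?lee_fin//; last first.
        by rewrite mulr_ge0 ?powR_ge0// exprn_ge0// ltW// ln_natr_gt0.
      rewrite leeD//; first by rewrite lee_wpmul2l ?lee_fin// lee_pemull.
      by rewrite mul1r lnd// mulrC EFinM muleA.
    apply: soft_bigOD => //; first exact: soft_bigO_scale.
    exact: soft_bigO_mul_ln.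
  - apply: (@soft_bigO_le _ _ (fun m => (2 * L * (k * D))%:E * (v m)%:E
      + (k * (k * D) * ln m%:R `^ d%:R)%:E * (v m)%:E)%E).
      move=> m m1; rewrite -!EFinM -EFinD lee_fin /Z lnd//.
      by rewrite le_eqVlt; apply/orP; left; apply/eqP; ring.
    apply: soft_bigOD => //.
      apply: soft_bigO_scale => //; first exact: mulr_ge0.
      exact: soft_bigO_refl.
    apply: soft_bigO_mul_ln => //; first exact: mulr_ge0.
    exact: soft_bigO_refl.
have [C [b [C0 b0 H]]] := UO; exists C, b; split => // n m theta m1 th.
have th1 : 0 < 1 - theta by case/andP: th => *; rewrite subr_gt0.
have lm := @ln_natr_gt0 R m m1.
have coef1 : 0 <= 2 * L + k * ln m%:R ^+ d.
  by rewrite addr_ge0// mulr_ge0// exprn_ge0// ltW.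
have coef2 : 0 <= L + m%:R `^ alpha * ln m%:R ^+ d.
  by rewrite addr_ge0// mulr_ge0 ?powR_ge0// exprn_ge0// ltW.
have Z0 : 0 <= Z m := mulr_ge0 (mulr_ge0 coef1 kD0) (v0 m).
have main0 : (0 <= (2 * L + k * ln m%:R ^+ d)%:E * A m
    + (L + m%:R `^ alpha * ln m%:R ^+ d)%:E * B m + (Z m)%:E)%E.
  by rewrite !adde_ge0 ?mule_ge0 ?lee_fin.
have U_risk : (risk n m <= (exp_sum n theta S)%:E + ((1 - theta)^-1)%:E * U m)%E.
  have [mM|Mm] := ltnP m M.
    apply: (le_trans (risk_le1 n m)); apply: (@le_trans _ _ (((1 - theta)^-1)%:E * U m)%E).
      apply: (@le_trans _ _ (((1 - theta)^-1)%:E * 1)%E).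
        by rewrite mule1 lee_fin invf_ge1//; case/andP: th => /ltW; lra.
      by rewrite lee_wpmul2l ?lee_fin ?invr_ge0 ?(ltW th1)// /U mM leeDr.
    by rewrite leeDr// lee_fin.
  have [ms mr] := large m Mm.
  by rewrite /U ltnNge Mm adde0; exact: (risk_le_large n m1 ms mr th uS SE).
apply: (le_trans U_risk); rewrite addeC leeD2r//.
apply: (le_trans (lee_wpmul2l _ (H m m1))); first by rewrite lee_fin invr_ge0 ltW.
rewrite -EFinM lee_fin /v le_eqVlt; apply/orP; left; apply/eqP.
by ring.
Qed.

End excess_risk.

Lemma sum_margin_le1 (R : realType) (d : nat)
    (P : probability ('rV[R]_d * bool)%type R) (p eta : 'rV[R]_d -> R)
    (Gamma : set 'rV[R]_d) (S : seq (set 'rV[R]_d)) :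
  measurable_fun setT p -> (forall x, 0 <= p x) -> is_density P p ->
  measurable_fun setT eta -> (forall x, 0 <= eta x <= 1) ->
  measurable Gamma -> uniq S ->
  (forall T, T \in S -> measurable T) -> (forall T, T \in S -> T `<=` Gamma) ->
  (forall T T' x, T \in S -> T' \in S -> T x -> T' x -> T = T') ->
  \sum_(T <- S) margin p eta T <= 1.
Proof.
move=> mp p0 pP meta eta01 mGamma uS mS SG disjS; rewrite -lee_fin -sumEFin.
apply: le_trans (margin_integral_le1 p0 pP eta01 mGamma).
rewrite big_seq (eq_bigr (fun T => \int[lebesgue_rV]_(x in T)
  (`|2 * eta x - 1| * p x)%:E)%E) -?big_seq; last first.
  by move=> T TS; rewrite (EFin_margin p0 pP eta01 (mS T TS)).
apply: (@sum_integral_disjoint_le _ _ _ lebesgue_rV _ S id) => //.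
  exact: measurable_margin_integrand.
by move=> x; rewrite mulr_ge0.
Qed.

Theorem theorem4p1 (R : realType) (d : nat)
    (X : set 'rV[R]_d) (P : probability ('rV[R]_d * bool)%type R)
    (p eta : 'rV[R]_d -> R) (L lam alpha c0 r0 s0 : R)
    (G : forall m, m.-tuple 'rV[R]_d -> set 'rV[R]_d)
    (Gamma := level_set X p lam) :
  (0 < d)%N ->
  measurable X -> (lebesgue_rV X < +oo)%E -> marginal_X P X = 1%E ->
  measurable_fun setT p -> (forall x, 0 <= p x <= L) -> is_density P p ->
  measurable_fun setT eta -> (forall x, 0 <= eta x <= 1) ->
  is_regression P eta ->
  0 < lam -> 0 < alpha -> 0 < c0 -> 0 < r0 -> 0 < s0 ->
  cluster_assumption eta Gamma ->
  set_estimator X G -> consistent_from_inside P alpha Gamma G ->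
  (forall T, components Gamma T -> r_connected c0 r0 T) ->
  separated_by s0 (components Gamma) ->
  (exists C b : R, [/\ 0 < C, 0 < b &
    forall n m (theta : R), (1 < m)%N -> 0 < theta < 1 ->
      (thresholded_risk P p eta Gamma (@classifier R d alpha G n m)
       <= (C * ln m%:R `^ b * (m%:R `^ (- alpha) / (1 - theta)))%:E
          + \esum_(T in components Gamma)
              (margin p eta T *
               expR (- (n%:R * (theta * margin p eta T) ^+ 2 / 2)))%:E)%E]) /\
  (forall delta : R, global_margin_assumption p eta Gamma delta ->
    exists C b : R, [/\ 0 < C, 0 < b &
    forall n m (theta : R), (1 < m)%N -> 0 < theta < 1 ->
      (thresholded_risk P p eta Gamma (@classifier R d alpha G n m)
       <= (C * ln m%:R `^ b * (m%:R `^ (- alpha) / (1 - theta))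
           + expR (- (n%:R * (theta * delta) ^+ 2 / 2)))%:E)%E]).
Proof.
move=> _ mX Xoo _ mp p0L pP meta eta01 etaP _ alpha0 c00 r00 s00 clus estG consG rG sG.
have mGamma : measurable Gamma := measurable_level_set lam mX mp.
have Goo := level_set_finite lam mX Xoo mp.
have p0 x : 0 <= p x by case/andP: (p0L x).
have finC := finite_components c00 r00 s00 mGamma rG sG Goo.
pose S : seq (set 'rV[R]_d) := finmap.enum_fset (fset_set (components Gamma)).
have uS : uniq S by exact: finmap.fset_uniq.
have SE : components Gamma = [set` S] by rewrite -[LHS](fset_setK finC).
have SC T : T \in S -> components Gamma T by rewrite SE.
have [C [b [C0 b0 H]]] := risk_soft_bound mX Xoo mp p0L pP meta eta01 etaP alpha0
  c00 r00 s00 clus rG sG estG consG uS SE.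
split.
  exists C, b; split => // n m theta m1 th.
  rewrite esum_fset//; last first.
    by move=> T _; rewrite lee_fin mulr_ge0 ?expR_ge0// (margin_ge0 p0 eta01).
  by rewrite fsbig_finite// sumEFin; exact: H.
move=> delta [delta0 gma]; exists C, b; split => // n m theta m1 th.
apply: (le_trans (H n m theta m1 th)); rewrite -EFinD lee_fin lerD2l.
set e := expR _.
apply: (@le_trans _ _ (\sum_(T <- S) margin p eta T * e)).
  rewrite big_seq [leRHS]big_seq; apply: ler_sum => T /SC CT.
  have [->|dT] := gma T CT; first by rewrite !mul0r.
  rewrite ler_wpM2l ?(margin_ge0 p0 eta01)// ler_expR lerN2 ler_pM2r//.
  rewrite ler_wpM2l//; case/andP: th => /ltW th0 _.
  by rewrite ler_sqr ?nnegrE ?mulr_ge0 ?(ltW delta0) ?(margin_ge0 p0 eta01)// ler_wpM2l.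
rewrite -mulr_suml ler_piMl ?expR_ge0//.
apply: (sum_margin_le1 mp p0 pP meta eta01 mGamma uS).
- by move=> T /SC; exact: (measurable_component s00 mGamma sG).
- by move=> T /SC; exact: component_sub.
- by move=> T T' x /SC CT /SC CT'; exact: (component_eq s00 sG CT CT').
Qed.
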